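(* Let $\mathscr{H}$ be a complex Hilbert space and $d\ge1$. If $\mathbf{A}\in\mathbb{B}^d(\mathscr{H})$, then $$w_e(\mathbf{A})\le\frac{\sqrt d}{4}\,w_e\left(|\mathbf{A}|^{1-t}+|\mathbf{A}|^{t}\right)w_e\left(|\mathbf{A}|^{t}+|\mathbf{A}^*|^{1-t}\right)$$ for all $t$, $0\le t\le1$.
   Context: $\mathbb{B}(\mathscr{H})$ is the algebra of bounded linear operators on the complex Hilbert space $\mathscr{H}$, and $\mathbb{B}^d(\mathscr{H})$ is the set of $d$-tuples of such operators. For $T\in\mathbb{B}(\mathscr{H})$, $|T|=(T^*T)^{1/2}$ and $|T|^0=I$ (identity operator). For $\mathbf{T}=(T_1,\ldots,T_d)$, the Euclidean operator radius is $w_e(\mathbf{T})=\sup\{(\sum_{k=1}^d|\langle T_kx,x\rangle|^2)^{1/2}:\|x\|=1\}$. Operations on tuples $\mathbf{A}=(A_1,\ldots,A_d)$ are componentwise: $|\mathbf{A}|^s=(|A_1|^s,\ldots,|A_d|^s)$, $|\mathbf{A}^*|^s=(|A_1^*|^s,\ldots,|A_d^*|^s)$, and sums are componentwise. *)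

(* Defs.v *)
From HB Require Import structures.
From mathcomp Require Import all_boot all_order all_algebra.
From mathcomp Require Import complex.
From mathcomp Require Import all_classical all_reals all_analysis.

Set Implicit Arguments.
Unset Strict Implicit.
Unset Printing Implicit Defensive.

Import Order.TTheory GRing.Theory Num.Theory.
Import numFieldNormedType.Exports.

Local Open Scope classical_set_scope.
Local Open Scope complex_scope.
Local Open Scope ring_scope.

(* Norms over R[i] take values in R[i]; [rnorm] is the same norm seen in R.
   It serves both for vectors and for complex scalars. *)
Definition rnorm (R : realType) (V : normedZmodType R[i]) (x : V) : R :=
  complex.Re `|x|.

Definition bounded_operator (R : realType) (H : normedModType R[i])
    (T : H -> H) : Prop :=
  exists M : R, forall x : H, rnorm (T x) <= M * rnorm x.

Definition opnorm (R : realType) (H : normedModType R[i]) (T : H -> H) : R :=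
  sup [set rnorm (T x) | x in [set x : H | rnorm x <= 1]].

(* The norm of H is the one induced by dot, so that, with the completeness of
   H, (H, dot) is a Hilbert space. dot is
   linear on the left and conjugate-linear on the right. *)
Definition hilbert_dot (R : realType) (H : normedModType R[i])
    (dot : {dot H for Num.conj}) : Prop :=
  forall x : H, dot x x = `|x| ^+ 2.

(* On a Hilbert space, a bounded operator satisfies this defining equation for
   exactly one map S, so the default value of xget is irrelevant. *)
Definition adjoint (R : realType) (H : normedModType R[i])
    (dot : {dot H for Num.conj}) (T : H -> H) : H -> H :=
  xget (fun=> 0) [set S : H -> H | forall x y : H, dot (T x) y = dot x (S y)].

Definition poly_op (R : realType) (H : normedModType R[i]) (p : {poly R})
    (T : H -> H) (x : H) : H :=
  \sum_(i < size p) (p`_i)%:C *: iter i T x.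

(* Q is f(P) in the sense of the continuous functional calculus of a positive
   operator P: the operator-norm limit of p_n(P) for real polynomials p_n that
   converge to f uniformly on [0, ||P||], an interval containing the spectrum
   of P. For f continuous on that interval, Q exists and is unique. *)
Definition is_funcalc (R : realType) (H : normedModType R[i]) (f : R -> R)
    (P Q : H -> H) : Prop :=
  exists p : nat -> {poly R},
    (forall e : R, 0 < e -> \forall n \near \oo,
       forall u : R, 0 <= u <= opnorm P -> `|(p n).[u] - f u| <= e) /\
    (forall e : R, 0 < e -> \forall n \near \oo,
       forall x : H, rnorm (poly_op (p n) P x - Q x) <= e * rnorm x).

(* P^s for P positive and s >= 0; since 0 `^ 0 = 1, P^0 is the identity. *)
Definition op_pow (R : realType) (H : normedModType R[i]) (P : H -> H)
    (s : R) : H -> H :=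
  xget (fun=> 0) [set Q : H -> H | is_funcalc (fun u : R => u `^ s) P Q].

Definition op_abs (R : realType) (H : normedModType R[i])
    (dot : {dot H for Num.conj}) (T : H -> H) : H -> H :=
  op_pow (adjoint dot T \o T) 2^-1.

(* [sup] of the empty set is 0, so the radius is 0 when H = {0}. *)
Definition euclidean_radius (R : realType) (H : normedModType R[i])
    (dot : {dot H for Num.conj}) (d : nat) (T : 'I_d -> H -> H) : R :=
  sup [set Num.sqrt (\sum_(k < d) rnorm (dot (T k x) x) ^+ 2)
      | x in [set x : H | rnorm x = 1]].

Definition tuple_adjoint (R : realType) (H : normedModType R[i])
    (dot : {dot H for Num.conj}) (d : nat) (T : 'I_d -> H -> H) :
    'I_d -> H -> H :=
  fun k => adjoint dot (T k).

Definition tuple_abs_pow (R : realType) (H : normedModType R[i])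
    (dot : {dot H for Num.conj}) (d : nat) (T : 'I_d -> H -> H) (s : R) :
    'I_d -> H -> H :=
  fun k => op_pow (op_abs dot (T k)) s.

Definition tuple_add (R : realType) (H : normedModType R[i]) (d : nat)
    (S T : 'I_d -> H -> H) : 'I_d -> H -> H :=
  fun k => S k \+ T k.

(* Main.v *)
Require Import Defs.
From mathcomp Require Import all_boot all_order all_algebra.
From mathcomp Require Import complex.
From mathcomp Require Import all_classical all_reals all_analysis.
From mathcomp Require Import ring lra zify.

Set Implicit Arguments.
Unset Strict Implicit.
Unset Printing Implicit Defensive.

Import Order.TTheory GRing.Theory Num.Theory.
Import numFieldNormedType.Exports.

Local Open Scope classical_set_scope.
Local Open Scope complex_scope.
Local Open Scope ring_scope.

(** The bound is proved for each operator separately. Let A be one of them, A' its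
    adjoint, P = |A|, N = |A'|, and let x be a unit vector. With the polar
    decomposition A = U P and W = U P^(1-t) one has A = W P^t, hence
    <A x, x> = <P^t x, W' x>, and polarization gives

      |<A x, x>| <= |y|^2 / 4,   y = P^t x + c W' x,

    for a suitable phase c ([dot_polar]). The mixed Schwarz inequalities

      |<P^t x, y>|^2  <= <P^t x, x> <P^t y, y>,
      |<W' x, y>|^2   <= <N^(1-t) x, x> <P^(1-t) y, y>

    bound |y|^2 = <P^t x, y> + c <W' x, y> by the geometric mean of
    <(P^t + N^(1-t)) x, x> and <(P^(1-t) + P^t) y, y>, that is by
    (wG wF)^(1/2) |y| when wF and wG are the two radii on the right-hand side.
    So |<A x, x>| <= wF wG / 4, and summing d squares yields the factor sqrt d.

    The partial isometry U is avoided ([numerical_bound]): W is replaced by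
    A r(P) p(P), where p = X r is a real polynomial with p(u)^2 close to u^(1-t)
    ([cutoff_poly]). Then A is close to A r(P) p(P) P^t because |A v| = |P v|
    ([abs_norm]), and the second Schwarz inequality follows from A P = N A
    ([abs_intertwine]).

    The existence of adjoints rests on the Riesz representation theorem
    ([riesz]). The functional calculus of a positive operator P rests on Bernstein
    polynomials, used twice. A polynomial positive on [0, ||P||] has nonnegative
    coefficients in a Bernstein basis of large degree ([bernstein_positive]); hence
    p(P) is a positive operator whenever p is nonnegative on [0, ||P||]
    ([nonneg_poly]) and ||p(P)|| is at most the supremum of |p| ([poly_op_norm]).
    Bernstein approximation of the powers u^s ([weierstrass]) then makes P^s
    exist as a norm limit ([funcalc_exists]). *)

(** * Real-valued norm and real inner product *)

Section RealNorm.
Context {R : realType}.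

Lemma rnormE (V : normedZmodType R[i]) (x : V) : `|x| = (rnorm x)%:C.
Proof. by rewrite /rnorm RRe_real ?normr_real. Qed.

Lemma rnorm_ge0 (V : normedZmodType R[i]) (x : V) : 0 <= rnorm x.
Proof. by rewrite -ler0c -rnormE. Qed.

Lemma rnorm0 (V : normedZmodType R[i]) : rnorm (0 : V) = 0.
Proof. by rewrite /rnorm normr0. Qed.

Lemma rnorm_eq0 (V : normedZmodType R[i]) (x : V) : rnorm x = 0 -> x = 0.
Proof. by move=> x0; apply/eqP; rewrite -normr_eq0 rnormE x0. Qed.

Lemma rnormN (V : normedZmodType R[i]) (x : V) : rnorm (- x) = rnorm x.
Proof. by rewrite /rnorm normrN. Qed.

Lemma rnormB (V : normedZmodType R[i]) (x y : V) : rnorm (x - y) = rnorm (y - x).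
Proof. by rewrite -rnormN opprB. Qed.

Lemma ler_rnormD (V : normedZmodType R[i]) (x y : V) :
  rnorm (x + y) <= rnorm x + rnorm y.
Proof. by rewrite -lecR rmorphD /= -!rnormE ler_normD. Qed.

Lemma rnormC (a : R[i]) : rnorm a^* = rnorm a.
Proof. by rewrite /rnorm norm_conjC. Qed.

Lemma rnorm_real (r : R) : rnorm (r%:C) = `|r|.
Proof. by rewrite /rnorm normc_def /= expr0n /= addr0 sqrtr_sqr. Qed.

Lemma rnorm_Re (a : R[i]) : `|complex.Re a| <= rnorm a.
Proof. by rewrite -lecR -rnormE normc_ge_Re. Qed.

Lemma rnormZ (V : normedModType R[i]) (a : R[i]) (x : V) :
  rnorm (a *: x) = rnorm a * rnorm x.
Proof. by apply: complexI; rewrite rmorphM /= -!rnormE normrZ. Qed.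

End RealNorm.

Section InnerProduct.
Context {R : realType} {H : normedModType R[i]} (dot : {dot H for Num.conj}).
Hypothesis Hdot : hilbert_dot dot.

(** The real part carries all the order arguments; [dot_phase] recovers the modulus
    of the complex product from it. *)
Definition ip (x y : H) : R := complex.Re (dot x y).

Lemma dotC x y : dot x y = (dot y x)^*.
Proof. by rewrite hermC /= expr0 mul1r. Qed.

Lemma dotDl x y z : dot (x + y) z = dot x z + dot y z.
Proof. by rewrite linearDl. Qed.
Lemma dotDr x y z : dot z (x + y) = dot z x + dot z y.
Proof. by rewrite linearD. Qed.
Lemma dotZl a x z : dot (a *: x) z = a * dot x z.
Proof. by rewrite linearZl_LR. Qed.
Lemma dotZr a x z : dot z (a *: x) = a^* * dot z x.
Proof. by rewrite linearZr_LR. Qed.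
Lemma dot0r z : dot z 0 = 0.
Proof. by rewrite linear0r. Qed.
Lemma dotNl x z : dot (- x) z = - dot x z.
Proof. by rewrite linearNl. Qed.
Lemma dotBl x y z : dot (x - y) z = dot x z - dot y z.
Proof. by rewrite dotDl dotNl. Qed.
Lemma dotBr x y z : dot z (x - y) = dot z x - dot z y.
Proof. by rewrite linearB. Qed.

Lemma ReD (a b : R[i]) : complex.Re (a + b) = complex.Re a + complex.Re b.
Proof. by case: a b => [? ?] []. Qed.
Lemma ReZ (r : R) (b : R[i]) : complex.Re (r%:C * b) = r * complex.Re b.
Proof. by case: b => a b /=; rewrite mul0r subr0. Qed.
Lemma ReC (a : R[i]) : complex.Re a^* = complex.Re a.
Proof. by case: a. Qed.

Lemma ipC x y : ip x y = ip y x.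
Proof. by rewrite /ip dotC ReC. Qed.
Lemma ipDl x y z : ip (x + y) z = ip x z + ip y z.
Proof. by rewrite /ip dotDl ReD. Qed.
Lemma ipDr x y z : ip z (x + y) = ip z x + ip z y.
Proof. by rewrite /ip dotDr ReD. Qed.
Lemma ipZl r x z : ip (r%:C *: x) z = r * ip x z.
Proof. by rewrite /ip dotZl ReZ. Qed.
Lemma ipZr r x z : ip z (r%:C *: x) = r * ip z x.
Proof. by rewrite ipC ipZl ipC. Qed.
Lemma ipNl x z : ip (- x) z = - ip x z.
Proof. by rewrite -(mulN1r (ip x z)) -ipZl rmorphN1 scaleN1r. Qed.
Lemma ipNr x z : ip z (- x) = - ip z x.
Proof. by rewrite ipC ipNl ipC. Qed.
Lemma ip0l z : ip 0 z = 0.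
Proof. by rewrite ipC /ip dot0r. Qed.

Definition ipE := (ipDl, ipDr, ipNl, ipNr, ipZl, ipZr).

Lemma ipxx x : ip x x = rnorm x ^+ 2.
Proof. by rewrite /ip Hdot rnormE -rmorphXn. Qed.

Lemma ip_le x y : ip x y <= rnorm x * rnorm y.
Proof.
have [x0|xN0] := eqVneq (rnorm x) 0.
  by rewrite (rnorm_eq0 x0) ip0l rnorm0 mul0r.
have [y0|yN0] := eqVneq (rnorm y) 0.
  by rewrite (rnorm_eq0 y0) ipC ip0l rnorm0 mulr0.
have xp : 0 < rnorm x by rewrite lt_def xN0 rnorm_ge0.
have yp : 0 < rnorm y by rewrite lt_def yN0 rnorm_ge0.
(* This vector vanishes exactly when x and y are positively proportional. *)
have := sqr_ge0 (rnorm ((rnorm y)%:C *: x - (rnorm x)%:C *: y)).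
rewrite -ipxx !ipE (ipC y x) !ipxx => h.
have : rnorm x * rnorm y * ip x y <= (rnorm x * rnorm y) * (rnorm x * rnorm y).
  by lra.
by rewrite ler_pM2l // mulr_gt0.
Qed.

Lemma dot_phase x y :
  exists2 e : R[i], rnorm e = 1 & dot (e *: x) y = (rnorm (dot x y))%:C.
Proof.
have [d0|dN0] := eqVneq (dot x y) 0.
  by exists 1; rewrite ?scale1r ?d0 ?rnorm0 // (rnorm_real 1) normr1.
have nN0 : `|dot x y| != 0 by rewrite normr_eq0.
exists ((dot x y)^* / `|dot x y|).
  apply: complexI; rewrite -rnormE normf_div norm_conjC normr_id divff //.
by rewrite dotZl mulrAC -(mulrC (dot x y)) -normCK expr2 mulfK ?rnormE.
Qed.

Lemma dot_le x y : rnorm (dot x y) <= rnorm x * rnorm y.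
Proof.
have [e e1 de] := dot_phase x y.
have := ip_le (e *: x) y; rewrite /ip de rnormZ e1 mul1r.
by [].
Qed.

Lemma rnormD_sqr x y : rnorm (x + y) ^+ 2 = rnorm x ^+ 2 + 2 * ip x y + rnorm y ^+ 2.
Proof. by rewrite -!ipxx !ipE (ipC y x); ring. Qed.

(** The optimal phase makes <x, e y> equal to |<x, y>|; then
    4 Re <x, e y> = |x + e y|^2 - |x - e y|^2, and the last square is dropped. *)
Lemma dot_polar x y :
  exists2 e : R[i], rnorm e = 1 & rnorm (dot x y) <= 4^-1 * rnorm (x + e *: y) ^+ 2.
Proof.
have [e e1 de] := dot_phase y x.
exists e => //.
have -> : rnorm (dot x y) = ip x (e *: y).
  by rewrite ipC /ip de dotC rnormC.
have := sqr_ge0 (rnorm (x - e *: y)).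
rewrite !rnormD_sqr rnormN ipNr; lra.
Qed.

Lemma dot_inj x y : (forall z, dot x z = dot y z) -> x = y.
Proof.
move=> h; apply/eqP; rewrite -subr_eq0; apply/eqP/rnorm_eq0/eqP.
by rewrite -sqrf_eq0 -ipxx /ip dotBl h subrr.
Qed.

End InnerProduct.

(** * Completeness and the Riesz representation theorem *)

Lemma complete_rnorm {R : realType} {H : completeNormedModType R[i]} (u : nat -> H) :
  (forall e : R, 0 < e -> exists N, forall n m, (N <= n)%N -> (N <= m)%N ->
     rnorm (u n - u m) <= e) ->
  exists l : H, forall e : R, 0 < e -> exists N, forall n, (N <= n)%N ->
     rnorm (u n - l) <= e.
Proof.
move=> hu.
have : cvg (u @ \oo).
  apply/cauchy_cvgP/cauchy_exP => e e0.
  have e0' : 0 < complex.Re e by move: e0; rewrite ltcE => /andP[].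
  have eE : e = (complex.Re e)%:C by rewrite RRe_real // gtr0_real.
  have e2 : 0 < complex.Re e / 2 by lra.
  have [N hN] := hu _ e2.
  exists (u N).
  exists N => //= n /= Nn; rewrite -ball_normE /= rnormE eE ltcR.
  by apply: le_lt_trans (hN _ _ (leqnn N) Nn) _; lra.
move=> /cvg_ex[l ul]; exists l => e e0.
move/cvgrPdist_le: ul => /(_ (e%:C)); rewrite ltcR => /(_ e0) [N _ hN]; exists N => n Nn.
by rewrite -lecR -rnormE distrC; exact: hN.
Qed.

Lemma le_epsP {R : realType} (x y C : R) :
  (forall e : R, 0 < e -> e <= 1 -> x <= y + C * e) -> x <= y.
Proof.
move=> h; rewrite leNgt; apply/negP => yx.
set D := `|C| + 1 + (x - y).
have D0 : 0 < D by rewrite /D; have := normr_ge0 C; lra.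
have CD : C < D by rewrite /D; have := ler_norm C; lra.
have e0 : 0 < (x - y) / D by rewrite divr_gt0 // subr_gt0.
have e1 : (x - y) / D <= 1 by rewrite ler_pdivrMr // /D; have := normr_ge0 C; lra.
have := h _ e0 e1.
have : C * ((x - y) / D) < x - y.
  by rewrite mulrA ltr_pdivrMr // mulrC ltr_pM2l // subr_gt0.
lra.
Qed.

Lemma invS_small {R : realType} (e : R) : 0 < e ->
  exists N : nat, forall n, (N <= n)%N -> n.+1%:R^-1 <= e.
Proof.
move=> e0; exists (Num.truncn e^-1) => n Nn.
rewrite -[leRHS]invrK lef_pV2 ?posrE ?invr_gt0 // ?ltr0n //.
apply: ltW; apply: lt_le_trans (truncnS_gt _) _.
by rewrite ler_nat.
Qed.

(** First variation of a quadratic energy at an a-approximate minimiser. *)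
Lemma quadratic_disc {F : realFieldType} (a d c : F) : 0 <= c ->
  (forall s, 0 <= a + s * d + 2^-1 * s ^+ 2 * c) -> d ^+ 2 <= 2 * a * c.
Proof.
move=> c0 h; have [c_eq0|cN0] := eqVneq c 0.
  have [->|dN0] := eqVneq d 0; first by rewrite c_eq0 mulr0 expr0n.
  by have := h (- (a + 1) / d); rewrite c_eq0 mulr0 addr0 divfK //; lra.
have cp : 0 < c by rewrite lt_def cN0.
have := h (- d / c).
have -> : a + - d / c * d + 2^-1 * (- d / c) ^+ 2 * c = (2 * a * c - d ^+ 2) / (2 * c).
  by field.
by rewrite pmulr_lge0 ?invr_gt0 ?mulr_gt0 // subr_ge0.
Qed.

Section Riesz.
Context {R : realType} {H : completeNormedModType R[i]} (dot : {dot H for Num.conj}).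
Hypothesis Hdot : hilbert_dot dot.
Notation ip := (ip dot).

(** Dirichlet principle: approximate minimisers of the energy
    |x|^2 / 2 - Re (phi x) form a Cauchy sequence by the parallelogram law, and the
    first variation at their limit vanishes. *)
Lemma riesz (phi : H -> R[i]) (M : R) :
  (forall a x y, phi (a *: x + y) = a * phi x + phi y) ->
  (forall x, rnorm (phi x) <= M * rnorm x) ->
  exists v : H, forall x, phi x = dot x v.
Proof.
move=> phiL phiM.
have phiD x y : phi (x + y) = phi x + phi y by rewrite -(scale1r x) phiL mul1r scale1r.
have phi0 : phi 0 = 0.
  by apply: (addrI (phi 0)); rewrite -phiD !addr0.
have phiZ a x : phi (a *: x) = a * phi x by rewrite -(addr0 (a *: x)) phiL phi0 !addr0.
pose f x := complex.Re (phi x).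
have fD x y : f (x + y) = f x + f y by rewrite /f phiD ReD.
have fZ r x : f (r%:C *: x) = r * f x by rewrite /f phiZ ReZ.
pose J x := 2^-1 * rnorm x ^+ 2 - f x.
have fM x : f x <= M * rnorm x.
  by apply: le_trans (phiM x); apply: le_trans (rnorm_Re _); exact: ler_norm.
have Jlb x : - (2^-1 * M ^+ 2) <= J x.
  rewrite /J; have := fM x; have := sqr_ge0 (rnorm x - M); rewrite sqrrB; lra.
pose E := range J.
have Ei : has_inf E.
  by split; [exists (J 0), 0 | exists (- (2^-1 * M ^+ 2)) => _ [x _ <-]; exact: Jlb].
pose m := inf E.
have Jm x : m <= J x by apply: (ge_inf Ei.2); exists x.
have exn (n : nat) : exists x, J x <= m + n.+1%:R^-1.
  have n0 : 0 < (n.+1%:R^-1 : R) by rewrite invr_gt0 ltr0n.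
  by have [_ [x _ <-] h] := inf_adherent n0 Ei; exists x; exact: ltW.
have [u uP] := choice exn.
have par x y : rnorm (x - y) ^+ 2 = 4 * (J x + J y - 2 * J ((2^-1)%:C *: (x + y))).
  rewrite /J fZ fD rnormZ rnorm_real exprMn ger0_norm ?invr_ge0 //.
  rewrite !(rnormD_sqr Hdot) rnormN ipNr.
  by field.
have cauchy n k (e : R) : 0 < e -> n.+1%:R^-1 <= e -> k.+1%:R^-1 <= e ->
    rnorm (u n - u k) ^+ 2 <= 8 * e.
  move=> e0 ne ke; rewrite par.
  have := le_trans (uP n) (lerD (lexx m) ne); have := le_trans (uP k) (lerD (lexx m) ke).
  have := Jm ((2^-1)%:C *: (u n + u k)); move: (J _) (J _) (J _) => a b c; lra.
have [v hv] : exists v : H, forall e : R, 0 < e -> exists N, forall n, (N <= n)%N ->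
     rnorm (u n - v) <= e.
  apply: complete_rnorm => e e0.
  have e80 : 0 < e ^+ 2 / 8 by rewrite divr_gt0 // exprn_gt0.
  have [N hN] := invS_small e80.
  exists N => n k Nn Nk.
  rewrite -(@ler_pXn2r _ 2) ?nnegrE ?rnorm_ge0 ?(ltW e0) //.
  apply: le_trans (cauchy n k _ e80 (hN _ Nn) (hN _ Nk)) _; lra.
have var n h : (ip (u n) h - f h) ^+ 2 <= 2 * n.+1%:R^-1 * rnorm h ^+ 2.
  set d := ip (u n) h - f h.
  have Jd s : J (u n + s%:C *: h) = J (u n) + s * d + 2^-1 * s ^+ 2 * rnorm h ^+ 2.
    rewrite /J /d fD fZ (rnormD_sqr Hdot) rnormZ rnorm_real ipZr exprMn.
    by rewrite real_normK ?num_real //; field.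
  have q s : 0 <= n.+1%:R^-1 + s * d + 2^-1 * s ^+ 2 * rnorm h ^+ 2.
    have := Jm (u n + s%:C *: h); rewrite Jd; have := uP n.
    move: n.+1%:R^-1 (J (u n)) (rnorm h ^+ 2) => a b c; lra.
  by apply: quadratic_disc q; rewrite exprn_ge0 ?rnorm_ge0.
(* Pass to the limit in the first variation at the approximate minimisers. *)
have fv h : f h = ip h v.
  have hle : (ip v h - f h) ^+ 2 <= 0.
    apply: (@le_epsP _ _ _ (4 * rnorm h ^+ 2 + 2 * rnorm h ^+ 2)) => e e0 e1.
    have [N1 hN1] := hv _ e0; have [N2 hN2] := invS_small e0.
    set n := maxn N1 N2.
    have := hN1 n (leq_maxl _ _); have := hN2 n (leq_maxr _ _).
    move: (var n h); set a := n.+1%:R^-1 => va ae ue.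
    have := ip_le Hdot (u n - v) h; have := ip_le Hdot (v - u n) h.
    rewrite (rnormB v) !ipE => i1 i2.
    have hh := rnorm_ge0 h.
    have ueh : rnorm (u n - v) * rnorm h <= e * rnorm h by rewrite ler_wpM2r.
    have iN : `|ip v h - ip (u n) h| <= e * rnorm h.
      by rewrite ler_norml; apply/andP; split; lra.
    have s1 : (ip v h - ip (u n) h) ^+ 2 <= e * rnorm h ^+ 2.
      rewrite -real_normK ?num_real //.
      have : `|ip v h - ip (u n) h| ^+ 2 <= (e * rnorm h) ^+ 2.
        by rewrite ler_pXn2r ?nnegrE ?mulr_ge0 // ltW.
      rewrite exprMn => /le_trans; apply.
      by rewrite ler_wpM2r ?exprn_ge0 // expr2 ler_piMr // ltW.
    have s2 : (ip (u n) h - f h) ^+ 2 <= 2 * e * rnorm h ^+ 2.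
      apply: le_trans va _; rewrite ler_wpM2r ?exprn_ge0 // ler_wpM2l //.
    have := sqr_ge0 ((ip v h - ip (u n) h) - (ip (u n) h - f h)).
    have := sqr_ge0 ((ip v h - f h)); rewrite !expr2 in s1 s2 *; nra.
  have /eqP : (ip v h - f h) ^+ 2 = 0 by apply/eqP; rewrite eq_le hle sqr_ge0.
  by rewrite sqrf_eq0 subr_eq0 ipC => /eqP.
exists v => x; apply/eqP; rewrite eq_complex; apply/andP; split.
  by apply/eqP; exact: fv.
have := fv ('i%C *: x); rewrite /f /ip phiZ dotZl.
(* The imaginary part at x is the real part at i x, up to sign. *)
have ReI (a : R[i]) : complex.Re ('i%C * a) = - complex.Im a by rewrite mulrC ReiNIm.
by rewrite !ReI => /oppr_inj ->.
Qed.

Lemma adjoint_exists (T : H -> H) : linear T -> bounded_operator T ->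
  exists S : H -> H, forall x y, dot (T x) y = dot x (S y).
Proof.
move=> TL [M TM].
have /choice[S hS] : forall y, exists v, forall x, dot (T x) y = dot x v.
  move=> y; apply: (@riesz (fun x => dot (T x) y) (M * rnorm y)).
    by move=> a x z; rewrite TL dotDl dotZl.
  move=> x; apply: le_trans (dot_le Hdot _ _) _.
  by rewrite -mulrA (mulrC (rnorm y)) mulrA ler_wpM2r ?rnorm_ge0.
by exists S => x y; rewrite hS.
Qed.

Lemma adjointP (T : H -> H) : linear T -> bounded_operator T ->
  forall x y, dot (T x) y = dot x (adjoint dot T y).
Proof.
move=> TL TM; rewrite /adjoint; case: xgetP => [//|no].
by have [S hS] := adjoint_exists TL TM; have /(_ S)/= := no.
Qed.

Lemma adjoint_linear (T S : H -> H) :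
  (forall x y, dot (T x) y = dot x (S y)) -> linear S.
Proof.
move=> TS a x y; apply: (dot_inj Hdot) => z; rewrite dotC -TS [RHS]dotC.
by rewrite !dotDr !dotZr !TS.
Qed.

Lemma adjoint_bounded (T S : H -> H) :
  (forall x y, dot (T x) y = dot x (S y)) -> bounded_operator T ->
  bounded_operator S.
Proof.
move=> TS [M TM]; exists M => x.
have [->|xN0] := eqVneq (rnorm (S x)) 0.
  by apply: le_trans (TM x); exact: rnorm_ge0.
have Sp : 0 < rnorm (S x) by rewrite lt_def xN0 rnorm_ge0.
rewrite -(ler_pM2r Sp) -expr2 -(ipxx Hdot) /ip -TS.
apply: le_trans (ip_le Hdot _ _) _; rewrite mulrAC ler_wpM2r ?rnorm_ge0 //.
Qed.

Lemma adjoint_sym (T S : H -> H) :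
  (forall x y, dot (T x) y = dot x (S y)) ->
  (forall x y, dot (S x) y = dot x (T y)).
Proof. by move=> TS x y; rewrite dotC -TS -dotC. Qed.

Lemma adjoint_unique (T S : H -> H) :
  (forall x y, dot (T x) y = dot x (S y)) -> bounded_operator T -> linear T ->
  adjoint dot T = S.
Proof.
move=> TS TB TL; apply/funext => x; apply: (dot_inj Hdot) => z.
by rewrite dotC -adjointP // TS [RHS]dotC.
Qed.

End Riesz.

(** * Bernstein polynomials *)

Section BernsteinIdentity.
Context {A : comNzRingType}.

Lemma mul_bin_swap (n j i : nat) : (i <= n)%N -> (j <= n)%N ->
  ('C(n, j) * 'C(n - j, i) = 'C(n - i, j) * 'C(n, i))%N.
Proof.
move=> i_n j_n; have [ij|ij] := leqP (i + j) n; last first.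
  by rewrite [X in (_ * X = _)%N]bin_small ?[X in (_ = X * _)%N]bin_small ?muln0 ?mul0n //; lia.
have p : (0 < j`! * i`! * (n - i - j)`!)%N by rewrite !muln_gt0 !fact_gt0.
apply/eqP; rewrite -(eqn_pmul2r p); apply/eqP.
have e1 := bin_fact j_n; have e2 := bin_fact i_n.
have /bin_fact e3 : (i <= n - j)%N by lia.
have /bin_fact e4 : (j <= n - i)%N by lia.
have e5 : (n - j - i = n - i - j)%N by lia.
rewrite e5 in e3.
transitivity n`!; first by rewrite -e1 -e3; ring.
by rewrite -e2 -e4; ring.
Qed.

(** The binomial theorem for (x + y)^(n - j). With y = 1 - x this writes the
    monomial x^j in the Bernstein basis of degree n, both for numbers (moments of
    the basis) and for polynomials (Bernstein coefficients). *)
Lemma bernstein_monomial (n j : nat) (x y : A) : (j <= n)%N ->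
  'C(n, j)%:R * (x ^+ j * (x + y) ^+ (n - j)) =
  \sum_(k < n.+1) ('C(k, j) * 'C(n, k))%:R * (x ^+ k * y ^+ (n - k)).
Proof.
move=> j_n; rewrite [RHS](reindex_inj rev_ord_inj) /= exprDn !mulr_sumr.
rewrite -(big_mkord xpredT (fun i => 'C(n, j)%:R *
   (x ^+ j * (x ^+ (n - j - i) * y ^+ i *+ 'C(n - j, i))))).
rewrite -(big_mkord xpredT (fun i => ('C(n.+1 - i.+1, j) * 'C(n, n.+1 - i.+1))%:R *
   (x ^+ (n.+1 - i.+1) * y ^+ (n - (n.+1 - i.+1))))).
rewrite [RHS](big_cat_nat (n := (n - j).+1)) //=; last by rewrite ltnS leq_subr.
rewrite [X in _ = _ + X]big_nat_cond [X in _ = _ + X]big1 ?addr0; last first.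
  move=> i; rewrite andbT => /andP[i1 i2].
  by rewrite bin_small ?mul0n ?mul0r //; lia.
rewrite !big_nat; apply: eq_bigr => i /andP[_ i1].
have i_n : (i <= n)%N by lia.
rewrite subSS subKn // bin_sub // -mul_bin_swap //.
have -> : (n - i = j + (n - j - i))%N by lia.
rewrite exprD -[_ *+ 'C(n - j, i)]mulr_natr natrM.
move: (x ^+ j) (x ^+ (n - j - i)) (y ^+ _) _%:R _%:R => a b c d e; ring.
Qed.

End BernsteinIdentity.

Section Bernstein.
Context {R : realType}.
Implicit Types (p : {poly R}) (f : R -> R).

Definition bernstein_basis (n k : nat) (u : R) : R := 'C(n, k)%:R * (u ^+ k * (1 - u) ^+ (n - k)).

Lemma bernstein_ge0 n k u : 0 <= u <= 1 -> 0 <= bernstein_basis n k u.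
Proof. by move=> /andP[u0 u1]; rewrite !mulr_ge0 // exprn_ge0 // subr_ge0. Qed.

Lemma bernstein_moment n j (u : R) : (j <= n)%N ->
  \sum_(k < n.+1) 'C(k, j)%:R * bernstein_basis n k u = 'C(n, j)%:R * u ^+ j.
Proof.
move=> jn; have := bernstein_monomial u (1 - u) jn.
rewrite addrC subrK expr1n mulr1 => ->.
by apply: eq_bigr => k _; rewrite /bernstein_basis natrM mulrA.
Qed.

Lemma bernstein_sum n (u : R) : \sum_(k < n.+1) bernstein_basis n k u = 1.
Proof.
have := @bernstein_moment n 0 u (leq0n n); rewrite bin0 mul1r expr0 => <-.
by apply: eq_bigr => k _; rewrite bin0 mul1r.
Qed.

Lemma bernstein_variance n (u : R) : (0 < n)%N ->
  \sum_(k < n.+1) (u - k%:R / n%:R) ^+ 2 * bernstein_basis n k u = u * (1 - u) / n%:R.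
Proof.
move=> n0; have nN0 : n%:R != 0 :> R by rewrite pnatr_eq0 -lt0n.
have m0 := @bernstein_moment n 0 u (leq0n n); have m1 := @bernstein_moment n 1 u n0.
have m2 : \sum_(k < n.+1) (k%:R * (k%:R - 1)) * bernstein_basis n k u = n%:R * (n%:R - 1) * u ^+ 2.
  have bin2R k : (k%:R * (k%:R - 1) : R) = 2 * 'C(k, 2)%:R.
    case: k => [|k]; first by rewrite mul0r mulr0.
    have := mul_bin_diag k.+1 1; rewrite bin1 /= => /(congr1 (fun m => m%:R : R)).
    by rewrite !natrM => <-; rewrite -natr1 addrK.
  case: n n0 nN0 {m0 m1} => [//|[|n]] n0 nN0.
    by rewrite !big_ord_recl big_ord0 /= subrr !(mul0r, mulr0, addr0).
  under eq_bigr do rewrite bin2R -mulrA.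
  by rewrite -mulr_sumr bernstein_moment // bin2R mulrA.
transitivity (u ^+ 2 * (\sum_(k < n.+1) 'C(k, 0)%:R * bernstein_basis n k u)
   + (n%:R ^- 2 - 2 * u / n%:R) * (\sum_(k < n.+1) 'C(k, 1)%:R * bernstein_basis n k u)
   + n%:R ^- 2 * (\sum_(k < n.+1) (k%:R * (k%:R - 1)) * bernstein_basis n k u)).
  rewrite !mulr_sumr -!big_split /=; apply: eq_bigr => k _.
  rewrite bin0 bin1; move: (bernstein_basis n k u) => b; by field.
rewrite m0 m1 m2 bin0 bin1; by field.
Qed.

Definition bernstein_poly (n : nat) f : {poly R} :=
  \sum_(k < n.+1) (f (k%:R / n%:R) * 'C(n, k)%:R) *: ('X^k * (1 - 'X) ^+ (n - k)).

Lemma horner_bernstein n f u :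
  (bernstein_poly n f).[u] = \sum_(k < n.+1) f (k%:R / n%:R) * bernstein_basis n k u.
Proof.
rewrite /bernstein_poly horner_sum; apply: eq_bigr => k _.
by rewrite /bernstein_basis !hornerE.
Qed.

(** On a compact interval this is continuity: jumps over long distances are absorbed
    by the quadratic term. In this form the error of the Bernstein polynomial is
    bounded directly by its variance [bernstein_variance]. *)
Definition quad_cont (K : R) f := forall e, 0 < e -> exists2 C, 0 <= C &
  forall u v, 0 <= u <= K -> 0 <= v <= K -> `|f u - f v| <= e + C * (u - v) ^+ 2.

Lemma node_itv n k : (k <= n)%N -> 0 <= (k%:R / n%:R : R) <= 1.
Proof.
move=> kn; rewrite divr_ge0 //=; case: n kn => [|n] kn; first by rewrite invr0 mulr0.
by rewrite ler_pdivrMr ?ltr0n // mul1r ler_nat.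
Qed.

(** The error of the Bernstein polynomial at u is an average of the differences
    f(k / n) - f(u), hence at most e / 2 + C u (1 - u) / n. Interpolation at 0 is
    used in [cutoff_poly] to factor X out of the approximant. *)
Lemma weierstrass01 f : quad_cont 1 f -> forall e, 0 < e ->
  exists2 p, p.[0] = f 0 & forall u : R, 0 <= u <= 1 -> `|p.[u] - f u| <= e.
Proof.
move=> fc e e0; have e2 : 0 < e / 2 by lra.
have [C C0 fC] := fc _ e2.
have [n hn] : exists n : nat, (0 < n)%N /\ C / n%:R <= e / 2.
  have : 0 < e / 2 / (C + 1) by rewrite divr_gt0 // ltr_wpDl.
  move=> /invS_small[N /(_ N (leqnn _))]; rewrite ler_pdivlMr; last by lra.
  set a := _^-1 => h; exists N.+1; split=> //; rewrite -/a.
  have : 0 <= a by rewrite invr_ge0.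
  by lra.
case: hn => n0 hn; exists (bernstein_poly n f).
  rewrite horner_bernstein big_ord_recl /= mul0r big1 ?addr0.
    by rewrite /bernstein_basis bin0 expr0 subr0 expr1n !mulr1.
  by move=> i _; rewrite /bernstein_basis /bump /= expr0n /= !(mul0r, mulr0).
move=> u u01; rewrite horner_bernstein.
have -> : f u = \sum_(k < n.+1) f u * bernstein_basis n k u.
  by rewrite -mulr_sumr bernstein_sum mulr1.
rewrite -sumrB; apply: le_trans (ler_norm_sum _ _ _) _.
apply: (@le_trans _ _ (\sum_(k < n.+1) (e / 2 * bernstein_basis n k u +
     C * ((u - k%:R / n%:R) ^+ 2 * bernstein_basis n k u)))).
  apply: ler_sum => k _; rewrite -mulrBl normrM (ger0_norm (bernstein_ge0 _ _ u01)).
  rewrite [C * _]mulrA -mulrDl ler_wpM2r ?bernstein_ge0 // distrC; apply: fC => //.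
  by apply: node_itv; rewrite -ltnS.
rewrite big_split /= -!mulr_sumr bernstein_sum mulr1 bernstein_variance //.
have -> : e = e / 2 + e / 2 by field.
rewrite {1}(_ : e / 2 + e / 2 = e); last by field.
rewrite lerD // ; apply: le_trans hn; rewrite mulrA ler_wpM2r ?invr_ge0 //.
by rewrite ler_piMr // ; case/andP: u01 => u0 u1; nra.
Qed.

Lemma weierstrass K f : 0 < K -> quad_cont K f -> forall e, 0 < e ->
  exists2 p, p.[0] = f 0 & forall u : R, 0 <= u <= K -> `|p.[u] - f u| <= e.
Proof.
move=> K0 fc e e0.
have fc1 : quad_cont 1 (fun u => f (K * u)).
  move=> a a0; have [C C0 fC] := fc a a0; exists (C * K ^+ 2) => [|u v /andP[u0 u1] /andP[v0 v1]].
    by rewrite mulr_ge0 ?exprn_ge0 // ltW.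
  rewrite -mulrA -exprMn mulrBr; apply: fC.
    by rewrite mulr_ge0 ?(ltW K0) //= ler_piMr // ltW.
  by rewrite mulr_ge0 ?(ltW K0) //= ler_piMr // ltW.
have [p p0 pf] := weierstrass01 fc1 e0.
exists (p \Po (K^-1 *: 'X)); first by rewrite horner_comp !hornerE p0 mulr0.
move=> u /andP[u0 uK]; rewrite horner_comp !hornerE.
have := pf (K^-1 * u); rewrite mulrA divff ?mul1r ?gt_eqF //; apply.
by rewrite mulr_ge0 ?invr_ge0 ?(ltW K0) //= mulrC ler_pdivrMr // mul1r.
Qed.

End Bernstein.

Section BernsteinPositivity.
Context {R : realType}.
Implicit Types (p : {poly R}) (f : R -> R).

(** The ratio is the product of the (k - i) / (n - i) for i < j, and each factor
    differs from k / n by at most i / n. *)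
Lemma falling_ratio (n k j : nat) : (0 < n)%N -> (j <= n)%N -> (k <= n)%N ->
  `|'C(k, j)%:R / 'C(n, j)%:R - (k%:R / n%:R) ^+ j| <= (j ^ 2)%:R / n%:R :> R.
Proof.
move=> n0; elim: j => [|j IH] jn kn.
  by rewrite !bin0 expr0 divr1 subrr normr0 mul0r.
have {IH} IH := IH (ltnW jn) kn.
set D := 'C(k, j)%:R / 'C(n, j)%:R in IH; set v := k%:R / n%:R in IH *.
have nR : 0 < n%:R :> R by rewrite ltr0n.
have /andP[v0 v1] : 0 <= v <= 1 by exact: node_itv.
have njR : 0 < (n - j)%:R :> R by rewrite ltr0n subn_gt0.
have CN0 : 'C(n, j)%:R != 0 :> R by rewrite pnatr_eq0 -lt0n bin_gt0 ltnW.
pose r : R := (k - j)%:R / (n - j)%:R.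
have rec m : 'C(m, j.+1)%:R = (m - j)%:R * 'C(m, j)%:R / j.+1%:R :> R.
  by apply: (canRL (mulfK _)); rewrite ?pnatr_eq0 // mulrC -!natrM mul_bin_left.
have -> : 'C(k, j.+1)%:R / 'C(n, j.+1)%:R = D * r.
  rewrite !rec /D /r; have jN0 : j.+1%:R != 0 :> R by rewrite pnatr_eq0.
  have bN0 := lt0r_neq0 njR; move: jN0 CN0 bN0; clear.
  move: j.+1%:R (n - j)%:R ('C(n, j)%:R) => a b c a0 c0 b0.
  by field; rewrite a0 b0 c0.
have D01 : 0 <= D <= 1.
  rewrite divr_ge0 //= ler_pdivrMr ?lt_def ?CN0 ?ler0n // mul1r ler_nat.
  exact: leq_bin2l.
have rv : `|r - v| <= j%:R / n%:R.
  rewrite ler_norml; case: (leqP j k) => kj; last first.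
    have r0 : r = 0 by rewrite /r (_ : (k - j = 0)%N) ?mul0r //; apply/eqP; rewrite subn_eq0 ltnW.
    rewrite r0 sub0r; apply/andP; split.
      by rewrite lerN2 /v ler_wpM2r ?invr_ge0 ?ler0n // ler_nat ltnW.
    by rewrite (@le_trans _ _ 0) ?oppr_le0 // divr_ge0.
  have -> : r - v = - (j%:R * ((n - k)%:R / (n - j)%:R) / n%:R).
    rewrite /r /v !natrB //; last exact: ltnW.
    by field; rewrite -natrB ?(ltnW jn) // !gt_eqF.
  have q0 : 0 <= ((n - k)%:R / (n - j)%:R : R) <= 1.
    by rewrite divr_ge0 //= ler_pdivrMr // mul1r ler_nat leq_sub2l.
  case/andP: q0 => q0 q1.
  rewrite lerN2 ler_wpM2r ?invr_ge0 ?ler_piMr //=.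
  by rewrite (@le_trans _ _ 0) ?oppr_le0 // !mulr_ge0 // invr_ge0.
have -> : D * r - v ^+ j.+1 = D * (r - v) + (D - v ^+ j) * v by rewrite exprSr; ring.
apply: le_trans (ler_normD _ _) _; rewrite (normrM D) (normrM _ v) (ger0_norm v0).
case/andP: D01 => D0 D1; rewrite (ger0_norm D0).
have h1 : D * `|r - v| <= j%:R / n%:R.
  by apply: le_trans rv; rewrite ler_piMl.
have h2 : `|D - v ^+ j| * v <= (j ^ 2)%:R / n%:R by apply: le_trans IH; rewrite ler_piMr.
apply: le_trans (lerD h1 h2) _; rewrite -mulrDl ler_wpM2r ?invr_ge0 ?ler0n //.
by rewrite -natrD ler_nat -!mulnn mulSn leq_add // leq_mul.
Qed.

(** By [falling_ratio] the Bernstein coefficients of degree n differ from the values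
    p(k / n) at the nodes by O(1 / n), uniformly in k, so for n large they inherit
    the sign of p. *)
Lemma bernstein_positive p e : 0 < e -> (forall u : R, 0 <= u <= 1 -> e <= p.[u]) ->
  exists n (c : nat -> R), (forall k, 0 <= c k) /\
    p = \sum_(k < n.+1) c k *: ('X^k * (1 - 'X) ^+ (n - k)).
Proof.
move=> e0 pe.
pose B := \sum_(j < size p) `|p`_j| * (j ^ 2)%:R.
have B0 : 0 <= B by apply: sumr_ge0 => j _; rewrite mulr_ge0.
have [N hN] : exists N : nat, forall n, (N <= n)%N -> (0 < n)%N -> B / n%:R <= e.
  have : 0 < e / (B + 1) by rewrite divr_gt0 // ltr_wpDl.
  move=> /invS_small[N hN]; exists N.+1 => -[//|n] Nn _.
  have := hN n Nn; rewrite ler_pdivlMr; last by lra.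
  have : 0 <= (n.+1%:R^-1 : R) by rewrite invr_ge0.
  by move: n.+1%:R^-1 => a; lra.
set n := (maxn N (size p)).+1.
pose c k := \sum_(j < size p) p`_j * ('C(k, j)%:R / 'C(n, j)%:R).
have cge0 k : (k <= n)%N -> 0 <= c k.
  move=> kn; have h := pe _ (@node_itv _ _ _ kn).
  have : `|c k - p.[k%:R / n%:R]| <= B / n%:R.
    rewrite horner_coef -sumrB /B mulr_suml; apply: le_trans (ler_norm_sum _ _ _) _.
    apply: ler_sum => j _; rewrite -mulrBr normrM -mulrA ler_wpM2l //.
    by apply: falling_ratio => //; have := ltn_ord j; rewrite /n; lia.
  have := hN n; rewrite ler_norml /n => /(_ _ isT) => hB /andP[h1 h2].
  have {}hB : B / n%:R <= e by apply: hB; rewrite leqW // leq_maxl.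
  by move: h1 h2 hB h; rewrite -/n; lra.
exists n, (fun k => if (k <= n)%N then c k * 'C(n, k)%:R else 0); split.
  by move=> k; case: ifP => // kn; rewrite mulr_ge0 // cge0.
transitivity (\sum_(j < size p) p`_j *: 'X^j).
  by rewrite -[LHS]coefK poly_def.
have mono (j : 'I_(size p)) : p`_j *: 'X^j = \sum_(k < n.+1)
    (p`_j * ('C(k, j)%:R / 'C(n, j)%:R) * 'C(n, k)%:R) *: ('X^k * (1 - 'X) ^+ (n - k)).
  have jn : (j <= n)%N by have := ltn_ord j; rewrite /n; lia.
  have := @bernstein_monomial {poly R} n j 'X (1 - 'X) jn.
  rewrite addrC subrK expr1n mulr1 => h.
  have CN0 : 'C(n, j)%:R != 0 :> R by rewrite pnatr_eq0 -lt0n bin_gt0.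
  transitivity ((p`_j / 'C(n, j)%:R) *: ('C(n, j)%:R * 'X^j : {poly R})).
    by rewrite mulr_natl -['X^j *+ _]scaler_nat scalerA divfK.
  rewrite h scaler_sumr; apply: eq_bigr => k _.
  rewrite mulr_natl -[(_ * _) *+ _]scaler_nat scalerA; congr (_ *: _).
  by rewrite natrM !mulrA (mulrAC p`_j).
rewrite (eq_bigr _ (fun j _ => mono j)) exchange_big /=; apply: eq_bigr => k _.
by rewrite -scaler_suml -ltnS ltn_ord mulr_suml.
Qed.

(** From c / (a + b) <= (c / (a + b))^s, applied to c = a and to c = b. *)
Lemma powR_subadd (s a b : R) : 0 <= s <= 1 -> 0 <= a -> 0 <= b ->
  (a + b) `^ s <= a `^ s + b `^ s.
Proof.
move=> /andP[s0 s1] a0 b0.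
have [->|sN0] := eqVneq s 0; first by rewrite !powRr0; lra.
have [->|aN0] := eqVneq a 0; first by rewrite add0r lerDr powR_ge0.
have [->|bN0] := eqVneq b 0; first by rewrite addr0 lerDl powR_ge0.
have ap : 0 < a by rewrite lt_def aN0.
have bp : 0 < b by rewrite lt_def bN0.
have ab : 0 < a + b by exact: addr_gt0.
have le c : 0 < c -> c <= a + b -> c / (a + b) * (a + b) `^ s <= c `^ s.
  move=> c0 cab.
  have -> : c `^ s = (c / (a + b)) `^ s * (a + b) `^ s.
    by rewrite -powRM ?divr_ge0 ?ltW // divfK // gt_eqF.
  rewrite ler_wpM2r ?powR_ge0 //; apply: ger1_powR => //.
  by rewrite divr_gt0 //= ler_pdivrMr // mul1r.
have := lerD (le a ap _) (le b bp _).
rewrite -!mulrDl divff ?gt_eqF // mul1r; apply; lra.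
Qed.

Lemma powR_holder (s u v : R) : 0 <= s <= 1 -> 0 <= u -> 0 <= v ->
  `|u `^ s - v `^ s| <= `|u - v| `^ s.
Proof.
move=> s01; wlog vu : u v / v <= u.
  move=> h u0 v0; case/orP: (le_total u v) => uv; last exact: h.
  by rewrite distrC (distrC u); exact: h.
move=> u0 v0.
have s0 : 0 <= s by case/andP: s01.
rewrite !ger0_norm ?subr_ge0 //; last by apply: ge0_ler_powR; rewrite ?nnegrE.
have uv : 0 <= u - v by rewrite subr_ge0.
by rewrite lerBlDl; have := powR_subadd s01 v0 uv; rewrite [v + _]addrC subrK.
Qed.

(** Short distances are controlled by the Hoelder estimate; beyond d = e^(1/s) the
    difference is at most K^s, which the quadratic term dominates. *)
Lemma quad_cont_powR (K s : R) : 0 <= s <= 1 -> 0 <= K -> quad_cont K (fun u => u `^ s).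
Proof.
move=> s01 K0 e e0.
have s0 : 0 <= s by case/andP: s01.
have [sE|sN0] := eqVneq s 0.
  exists 0 => // u v _ _; rewrite sE !powRr0 subrr normr0 mul0r addr0; exact: ltW.
have sp : 0 < s by rewrite lt_def sN0.
pose d := e `^ s^-1.
have d0 : 0 < d by exact: powR_gt0.
exists (K `^ s / d ^+ 2); first by rewrite divr_ge0 ?powR_ge0 // exprn_ge0 // ltW.
move=> u v /andP[u0 uK] /andP[v0 vK]; apply: le_trans (powR_holder s01 u0 v0) _.
have [uv|uv] := leP `|u - v| d.
  rewrite -[leLHS]addr0; apply: lerD; last first.
    by rewrite mulr_ge0 ?sqr_ge0 // divr_ge0 ?powR_ge0 // exprn_ge0 // ltW.
  apply: (@le_trans _ _ (d `^ s)).
    by apply: ge0_ler_powR; rewrite ?nnegrE // ltW.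
  by rewrite /d -powRrM mulVf // powRr1 // ltW.
rewrite -[leLHS]add0r; apply: lerD; first exact: ltW.
apply: (@le_trans _ _ (K `^ s)).
  by apply: ge0_ler_powR; rewrite ?nnegrE // ler_norml; apply/andP; split; lra.
rewrite -mulrA ler_peMr ?powR_ge0 // mulrC ler_pdivlMr ?exprn_gt0 // mul1r.
by rewrite -(real_normK (num_real (u - v))) ler_pXn2r ?nnegrE // ltW.
Qed.

Lemma quad_cont_lip (K L : R) f : 0 <= L ->
  (forall u v, 0 <= u <= K -> 0 <= v <= K -> `|f u - f v| <= L * `|u - v|) ->
  quad_cont K f.
Proof.
move=> L0 fL e e0; exists (L ^+ 2 / (4 * e)).
  by rewrite divr_ge0 ?exprn_ge0 // mulr_ge0 // ltW.
move=> u v hu hv; apply: le_trans (fL u v hu hv) _.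
rewrite -(real_normK (num_real (u - v))); move: `|u - v| => a.
rewrite -subr_ge0.
have -> : e + L ^+ 2 / (4 * e) * a ^+ 2 - L * a = (2 * e - L * a) ^+ 2 / (4 * e).
  by field; rewrite gt_eqF.
by rewrite divr_ge0 ?sqr_ge0 // mulr_ge0 // ltW.
Qed.

Lemma quad_cont_bounded (K : R) f : 0 <= K -> quad_cont K f ->
  exists2 C, 0 < C & forall u : R, 0 <= u <= K -> `|f u| <= C.
Proof.
move=> K0 fc; have [C C0 fC] := fc 1 ltr01.
exists (1 + C * K ^+ 2 + `|f 0|) => [|u uK].
  have := normr_ge0 (f 0); have := mulr_ge0 C0 (sqr_ge0 K); lra.
have := fC u 0 uK; rewrite lexx K0 subr0 => /(_ isT) h.
have {}h : `|f u - f 0| <= 1 + C * K ^+ 2.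
  apply: le_trans h _; rewrite lerD2l ler_wpM2l //.
  by case/andP: uK => u0 uK; rewrite ler_pXn2r ?nnegrE.
by have := ler_normD (f u - f 0) (f 0); rewrite subrK; lra.
Qed.

Lemma quad_contM (K : R) f g : 0 <= K -> quad_cont K f -> quad_cont K g ->
  quad_cont K (fun u => f u * g u).
Proof.
move=> K0 fc gc e e0.
have [F F0 fF] := quad_cont_bounded K0 fc.
have [G G0 gG] := quad_cont_bounded K0 gc.
have e1 : 0 < e / (2 * G) by rewrite divr_gt0 // mulr_gt0.
have e2 : 0 < e / (2 * F) by rewrite divr_gt0 // mulr_gt0.
have [C C0 fC] := fc _ e1; have [D D0 gD] := gc _ e2.
exists (C * G + D * F) => [|u v hu hv]; first by rewrite addr_ge0 // mulr_ge0 // ltW.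
have -> : f u * g u - f v * g v = (f u - f v) * g u + (g u - g v) * f v by ring.
apply: le_trans (ler_normD _ _) _; rewrite !normrM.
have h1 := ler_pM (normr_ge0 _) (normr_ge0 _) (fC u v hu hv) (gG u hu).
have h2 := ler_pM (normr_ge0 _) (normr_ge0 _) (gD u v hu hv) (fF v hv).
apply: le_trans (lerD h1 h2) _.
rewrite le_eqVlt; apply/orP; left; apply/eqP.
by field; rewrite !gt_eqF.
Qed.

End BernsteinPositivity.

(** * Polynomials of an operator *)

Section PolyOp.
Context {R : realType} {H : normedModType R[i]}.
Implicit Types (T : H -> H) (p q : {poly R}).

Lemma poly_op_wide n p T x : (size p <= n)%N ->
  poly_op p T x = \sum_(i < n) (p`_i)%:C *: iter i T x.
Proof.
move=> pn; rewrite /poly_op (big_ord_widen n (fun i => (p`_i)%:C *: iter i T x)) //.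
rewrite big_mkcond /=; apply: eq_bigr => i _; case: ltnP => // h.
by rewrite nth_default // scale0r.
Qed.

Lemma poly_opD p q T x : poly_op (p + q) T x = poly_op p T x + poly_op q T x.
Proof.
set n := maxn (size p) (size q).
rewrite !(@poly_op_wide n) ?leq_maxl ?leq_maxr ?size_polyD //.
rewrite -big_split /=; apply: eq_bigr => i _.
by rewrite coefD rmorphD scalerDl.
Qed.

Lemma poly_opZ a p T x : poly_op (a *: p) T x = a%:C *: poly_op p T x.
Proof.
rewrite !(@poly_op_wide (size p)) ?size_scale_leq // scaler_sumr.
by apply: eq_bigr => i _; rewrite coefZ rmorphM scalerA.
Qed.

Lemma poly_opN p T x : poly_op (- p) T x = - poly_op p T x.
Proof. by rewrite -scaleN1r poly_opZ rmorphN1 scaleN1r. Qed.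

Lemma poly_opB p q T x : poly_op (p - q) T x = poly_op p T x - poly_op q T x.
Proof. by rewrite poly_opD poly_opN. Qed.

Lemma poly_opC c T x : poly_op c%:P T x = c%:C *: x.
Proof.
by rewrite (@poly_op_wide 1) ?size_polyC_leq1 // big_ord1 coefC.
Qed.

Lemma poly_op0 T x : poly_op 0 T x = 0.
Proof. by rewrite -polyC0 poly_opC scale0r. Qed.

Section Linear.
Variable T : H -> H.
Hypothesis T_lin : linear T.

Lemma lin0 : T 0 = 0.
Proof.
by apply: (addrI (T 0)); have := T_lin 1 0 0; rewrite !scale1r !addr0 => {1}<-.
Qed.

Lemma linD x y : T (x + y) = T x + T y.
Proof. by have := T_lin 1 x y; rewrite !scale1r. Qed.

Lemma linZ a x : T (a *: x) = a *: T x.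
Proof. by have := T_lin a x 0; rewrite lin0 !addr0. Qed.

Lemma linB x y : T (x - y) = T x - T y.
Proof. by rewrite linD -scaleN1r linZ scaleN1r. Qed.

Lemma lin_sum (I : Type) (r : seq I) (F : I -> H) :
  T (\sum_(i <- r) F i) = \sum_(i <- r) T (F i).
Proof. by elim/big_rec2: _ => [|i y x _ <-]; rewrite ?lin0 // linD. Qed.

Lemma poly_opXM p x : poly_op ('X * p) T x = T (poly_op p T x).
Proof.
rewrite mulrC (@poly_op_wide (size p).+1); last first.
  by apply: leq_trans (size_polyMleq _ _) _; rewrite size_polyX addn2.
rewrite big_ord_recl coefMX /= scale0r add0r lin_sum.
by apply: eq_bigr => i _; rewrite coefMX /= linZ.
Qed.

Lemma poly_opX x : poly_op 'X T x = T x.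
Proof. by rewrite -['X]mulr1 poly_opXM -polyC1 poly_opC scale1r. Qed.

Lemma poly_opM p q x : poly_op (p * q) T x = poly_op p T (poly_op q T x).
Proof.
elim/poly_ind: p => [|p c IH]; first by rewrite mul0r !poly_op0.
by rewrite mulrDl mul_polyC !poly_opD poly_opZ poly_opC -mulrA (mulrC p) -mulrA
  (mulrC q) !poly_opXM IH (mulrC p) poly_opXM.
Qed.

Lemma poly_op_linear p : linear (poly_op p T).
Proof.
move=> a x y; elim/poly_ind: p => [|p c IH].
  by rewrite !poly_op0 scaler0 addr0.
rewrite !poly_opD !poly_opC (mulrC p) !poly_opXM IH T_lin.
by rewrite !scalerDr !scalerA (mulrC a) addrACA.
Qed.

End Linear.

Lemma poly_op_intertwine (A S T : H -> H) p x :
  linear A -> linear S -> linear T -> (forall y, A (S y) = T (A y)) ->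
  A (poly_op p S x) = poly_op p T (A x).
Proof.
move=> AL SL TL AST; elim/poly_ind: p => [|p c IH].
  by rewrite !poly_op0 lin0.
by rewrite !poly_opD !poly_opC linD // linZ // (mulrC p) !poly_opXM // AST IH.
Qed.

Lemma opnorm_ub (T : H -> H) x : linear T -> bounded_operator T ->
  rnorm (T x) <= opnorm T * rnorm x.
Proof.
move=> TL [M TM].
have ubs : has_sup [set rnorm (T x) | x in [set x : H | rnorm x <= 1]].
  split; first by exists (rnorm (T 0)), 0 => //=; rewrite rnorm0.
  exists `|M| => _ [y /= y1 <-]; apply: le_trans (TM y) _.
  apply: (@le_trans _ _ (`|M| * rnorm y)); first by rewrite ler_wpM2r ?rnorm_ge0 ?ler_norm.
  by rewrite ler_piMr.
have [x0|xN0] := eqVneq (rnorm x) 0.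
  by rewrite (rnorm_eq0 x0) lin0 // rnorm0 mulr0.
have xp : 0 < rnorm x by rewrite lt_def xN0 rnorm_ge0.
rewrite -ler_pdivrMr //; apply: ub_le_sup; first exact: ubs.2.
have e : `|(rnorm x)^-1| = (rnorm x)^-1 by rewrite ger0_norm // invr_ge0 rnorm_ge0.
exists (((rnorm x)^-1)%:C *: x) => /=; rewrite ?linZ // rnormZ rnorm_real e.
  by rewrite mulVf.
by rewrite mulrC.
Qed.

Lemma opnorm_ge0 (T : H -> H) : bounded_operator T -> 0 <= opnorm T.
Proof.
move=> [M TM]; apply: (le_trans (rnorm_ge0 (T 0))); apply: ub_le_sup.
  exists `|M| => _ [y /= y1 <-]; apply: le_trans (TM y) _.
  apply: (@le_trans _ _ (`|M| * rnorm y)); first by rewrite ler_wpM2r ?rnorm_ge0 ?ler_norm.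
  by rewrite ler_piMr.
by exists 0 => //=; rewrite rnorm0.
Qed.

End PolyOp.

(** * Positive operators *)

Section Positivity.
Context {R : realType} {H : normedModType R[i]} (dot : {dot H for Num.conj}).
Hypothesis Hdot : hilbert_dot dot.
Notation ip := (ip dot).

Record pos_op (P : H -> H) : Prop := PosOp {
  pos_lin : linear P;
  pos_bnd : bounded_operator P;
  pos_sym : forall x y, dot (P x) y = dot x (P y);
  pos_ge0 : forall x, 0 <= ip (P x) x }.

Variable P : H -> H.
Hypothesis Ppos : pos_op P.
Let PL := pos_lin Ppos.

Lemma poly_op_sym p x y : dot (poly_op p P x) y = dot x (poly_op p P y).
Proof.
elim/poly_ind: p x y => [|p c IH] x y.
  by rewrite !poly_op0 dot0r dotC dot0r conjC0.
rewrite !poly_opD !poly_opC dotDl dotDr dotZl dotZr !poly_opM // IH !poly_opX //.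
rewrite (pos_sym Ppos); congr (_ + _ * _); last by rewrite -[RHS]/(conjc _) conjc_real.
by congr (dot x _); exact: poly_op_intertwine.
Qed.

Definition poly_op_nonneg p := forall x, 0 <= ip (poly_op p P x) x.

Lemma nonnegD p q : poly_op_nonneg p -> poly_op_nonneg q -> poly_op_nonneg (p + q).
Proof. by move=> hp hq x; rewrite poly_opD ipDl addr_ge0. Qed.

Lemma nonneg_sum (I : Type) (r : seq I) (F : I -> {poly R}) :
  (forall i, poly_op_nonneg (F i)) -> poly_op_nonneg (\sum_(i <- r) F i).
Proof.
by move=> h; elim/big_rec: _ => [x|i p _]; [rewrite poly_op0 ip0l | exact: nonnegD].
Qed.

Lemma nonnegZ c p : 0 <= c -> poly_op_nonneg p -> poly_op_nonneg (c *: p).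
Proof. by move=> c0 hp x; rewrite poly_opZ ipZl mulr_ge0. Qed.

Lemma nonneg_conj p q : poly_op_nonneg q -> poly_op_nonneg (p * q * p).
Proof.
by move=> hq x; rewrite -mulrA !poly_opM // /ip poly_op_sym; exact: hq.
Qed.

(** Removing squares leaves the factors Y^a (1 - Y)^b with a, b <= 1. The product
    Y (1 - Y) is not a square, but it equals
    Y (1 - Y) Y + (1 - Y) Y (1 - Y), a sum of conjugates of nonnegative factors. *)
Lemma nonneg_bernstein (Y : {poly R}) k l : poly_op_nonneg Y -> poly_op_nonneg (1 - Y) ->
  poly_op_nonneg (Y ^+ k * (1 - Y) ^+ l).
Proof.
move=> nY n1Y.
have nYY : poly_op_nonneg (Y * (1 - Y)).
  have -> : Y * (1 - Y) = Y * (1 - Y) * Y + (1 - Y) * Y * (1 - Y) by ring.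
  by apply: nonnegD; exact: nonneg_conj.
have n1 : poly_op_nonneg 1 by move=> x; rewrite -polyC1 poly_opC scale1r ipxx // sqr_ge0.
have -> : Y ^+ k * (1 - Y) ^+ l = (Y ^+ k./2 * (1 - Y) ^+ l./2) *
    (Y ^+ odd k * (1 - Y) ^+ odd l) * (Y ^+ k./2 * (1 - Y) ^+ l./2).
  rewrite -{1}(odd_double_half k) -{1}(odd_double_half l) -!addnn !exprD; ring.
apply: nonneg_conj.
case: (odd k) (odd l) => [] [] /=; rewrite ?expr0 ?expr1 ?mul1r ?mulr1 //.
Qed.

(** Add e > 0, rescale the interval to [0, 1], and expand in a Bernstein basis: every
    term is nonnegative by [nonneg_bernstein]. *)
Lemma nonneg_poly p : (forall u : R, 0 <= u <= opnorm P -> 0 <= p.[u]) -> poly_op_nonneg p.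
Proof.
move=> p0 x; have PB := pos_bnd Ppos; set M := opnorm P in p0.
have M0 : 0 <= M by exact: opnorm_ge0.
have Pz := @opnorm_ub _ _ P _ PL PB.
(* When the interval is {0} there is nothing to rescale, but then P = 0. *)
have [ME|MN0] := eqVneq M 0.
  have P0 y : P y = 0.
    apply: rnorm_eq0; apply/eqP; rewrite eq_le rnorm_ge0 andbT.
    by have := Pz y; rewrite -/M ME mul0r.
  elim/poly_ind: p p0 => [p0|p c _ p0]; first by rewrite poly_op0 ip0l.
  rewrite poly_opD poly_opM // poly_opX // P0 (lin0 (poly_op_linear PL p)) add0r.
  rewrite poly_opC ipZl ipxx // mulr_ge0 ?sqr_ge0 //.
  by have := p0 0; rewrite lexx M0 !hornerE; apply.
have Mp : 0 < M by rewrite lt_def MN0.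
apply: (@le_epsP _ _ _ (rnorm x ^+ 2)) => e e0 _.
pose Y : {poly R} := M^-1 *: 'X.
have nY : poly_op_nonneg Y.
  by apply: nonnegZ => [|y]; rewrite ?invr_ge0 // poly_opX //; exact: pos_ge0.
have n1Y : poly_op_nonneg (1 - Y).
  move=> y; rewrite poly_opB -polyC1 poly_opC scale1r poly_opZ poly_opX // !ipE ipxx //.
  rewrite subr_ge0 mulrC ler_pdivrMr //; apply: le_trans (ip_le Hdot _ _) _.
  by apply: le_trans (ler_wpM2r (rnorm_ge0 y) (Pz y)) _; rewrite -/M expr2 -mulrA mulrC.
pose q := (p \Po (M *: 'X)) + e%:P.
have qe u : 0 <= u <= 1 -> e <= q.[u].
  move=> /andP[u0 u1]; rewrite /q hornerD hornerC horner_comp !hornerE lerDr.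
  by apply: p0; rewrite mulr_ge0 //= ler_piMr.
have [n [c [c0 qE]]] := bernstein_positive e0 qe.
have : poly_op_nonneg (p + e%:P).
  have -> : p + e%:P = q \Po Y.
    rewrite /q comp_polyD comp_polyC -comp_polyA comp_polyZ comp_polyX /Y scalerA.
    by rewrite divff // scale1r comp_polyXr.
  rewrite qE raddf_sum; apply: nonneg_sum => k /=.
  rewrite comp_polyZ comp_polyM !rmorphXn /= comp_polyB comp_polyX comp_polyC.
  by apply: nonnegZ => //; exact: nonneg_bernstein.
move/(_ x); rewrite poly_opD poly_opC ipDl ipZl ipxx // mulrC.
by [].
Qed.

(** c^2 - p^2 is nonnegative on the interval, and <p(P)^2 x, x> = |p(P) x|^2. *)
Lemma poly_op_norm p c : (forall u : R, 0 <= u <= opnorm P -> `|p.[u]| <= c) ->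
  forall x, rnorm (poly_op p P x) <= c * rnorm x.
Proof.
move=> pc x; have M0 := opnorm_ge0 (pos_bnd Ppos).
have c0 : 0 <= c by apply: le_trans (pc 0 _); rewrite ?lexx.
have /(_ x) : poly_op_nonneg ((c ^+ 2)%:P - p * p).
  apply: nonneg_poly => u hu; rewrite !hornerE subr_ge0 -expr2.
  by rewrite -(real_normK (num_real p.[u])) ler_pXn2r ?nnegrE ?pc.
rewrite poly_opB poly_opC poly_opM // !ipE /ip poly_op_sym -!/(ip _ _) !ipxx //.
by rewrite -exprMn subr_ge0 ler_pXn2r ?nnegrE ?mulr_ge0 ?rnorm_ge0.
Qed.

End Positivity.

(** * Continuous functional calculus *)

Section FunCalc.
Context {R : realType} {H : normedModType R[i]} (dot : {dot H for Num.conj}).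
Hypothesis Hdot : hilbert_dot dot.
Notation ip := (ip dot).
Variable P : H -> H.
Hypothesis Ppos : pos_op dot P.
Let PL := pos_lin Ppos.
Implicit Types (f g : R -> R) (Q : H -> H) (p q : {poly R}) (e : R).

(** Equivalent to [is_funcalc], with one polynomial for each error in place of a
    sequence. *)
Definition approx_funcalc f Q := forall e, 0 < e -> exists p : {poly R},
  (forall u : R, 0 <= u <= opnorm P -> `|p.[u] - f u| <= e) /\
  (forall x, rnorm (poly_op p P x - Q x) <= e * rnorm x).

Lemma approx_of_is_funcalc f Q : is_funcalc f P Q -> approx_funcalc f Q.
Proof.
move=> [p [h1 h2]] e e0.
by have [n [? ?]] := filter_ex (filterI (h1 e e0) (h2 e e0)); exists (p n).
Qed.

Lemma is_funcalc_of_approx f Q : approx_funcalc f Q -> is_funcalc f P Q.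
Proof.
move=> h; have ex (n : nat) : exists p : {poly R},
    (forall u : R, 0 <= u <= opnorm P -> `|p.[u] - f u| <= n.+1%:R^-1) /\
    (forall x, rnorm (poly_op p P x - Q x) <= n.+1%:R^-1 * rnorm x).
  by apply: h; rewrite invr_gt0.
have [p hp] := choice ex; exists p; split=> e e0.
  have [N hN] := invS_small e0; exists N => //= n Nn u hu.
  by apply: le_trans ((hp n).1 u hu) _; exact: hN.
have [N hN] := invS_small e0; exists N => //= n Nn x.
by apply: le_trans ((hp n).2 x) _; rewrite ler_wpM2r ?rnorm_ge0 //; exact: hN.
Qed.

Lemma poly_bounded K p : 0 <= K -> exists2 C, 0 <= C &
  forall u : R, 0 <= u <= K -> `|p.[u]| <= C.
Proof.
move=> K0; exists (\sum_(i < size p) `|p`_i| * K ^+ i) => [|u /andP[u0 uK]].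
  by apply: sumr_ge0 => i _; rewrite mulr_ge0 // exprn_ge0.
rewrite horner_coef; apply: le_trans (ler_norm_sum _ _ _) _.
apply: ler_sum => i _; rewrite normrM ler_wpM2l // normrX (ger0_norm u0).
by apply: lerXn2r; rewrite ?nnegrE.
Qed.

Lemma opnormP0 : 0 <= opnorm P.
Proof. exact: opnorm_ge0 (pos_bnd Ppos). Qed.

Lemma funcalc_fun_bounded f Q : approx_funcalc f Q -> exists2 C, 0 <= C &
  forall u : R, 0 <= u <= opnorm P -> `|f u| <= C.
Proof.
move=> /(_ 1 ltr01)[p [pf _]]; have [C C0 pC] := poly_bounded p opnormP0.
exists (C + 1) => [|u hu]; first by rewrite addr_ge0.
have := ler_normD (p.[u]) (f u - p.[u]); rewrite addrC subrK (distrC (f u)) => h.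
by apply: le_trans h _; rewrite lerD ?pC ?pf.
Qed.

(** Any polynomial close to f on the interval works, whichever polynomials define Q.
    Hence one polynomial can serve two operators at once, as in
    [abs_intertwine]. *)
Lemma funcalc_dist f Q p c : approx_funcalc f Q ->
  (forall u : R, 0 <= u <= opnorm P -> `|p.[u] - f u| <= c) ->
  forall x, rnorm (poly_op p P x - Q x) <= c * rnorm x.
Proof.
move=> h pc x; apply: (@le_epsP _ _ _ (2 * rnorm x)) => e e0 _.
have [q [qf qQ]] := h e e0.
have -> : poly_op p P x - Q x = poly_op (p - q) P x + (poly_op q P x - Q x).
  by rewrite poly_opB addrA subrK.
apply: le_trans (ler_rnormD _ _) _.
have h1 : rnorm (poly_op (p - q) P x) <= (c + e) * rnorm x.
  apply: (poly_op_norm Hdot Ppos) => u hu.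
  rewrite hornerD hornerN (_ : _ - _ = (p.[u] - f u) - (q.[u] - f u)); last by ring.
  by apply: le_trans (ler_normB _ _) _; rewrite lerD ?pc ?qf.
have h2 := qQ x; have := rnorm_ge0 x; lra.
Qed.

Lemma funcalc_norm f Q c : approx_funcalc f Q ->
  (forall u : R, 0 <= u <= opnorm P -> `|f u| <= c) ->
  forall x, rnorm (Q x) <= c * rnorm x.
Proof.
move=> h fcc x; rewrite -rnormN -[- _]add0r -(poly_op0 P x).
by apply: (funcalc_dist h) => u hu; rewrite horner0 sub0r normrN fcc.
Qed.

Lemma rnorm_small (x : H) (C : R) :
  (forall e, 0 < e -> e <= 1 -> rnorm x <= C * e) -> x = 0.
Proof.
move=> h; apply: rnorm_eq0; apply/eqP; rewrite eq_le rnorm_ge0 andbT.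
by apply: (@le_epsP _ _ _ C) => e e0 e1; rewrite add0r; exact: h.
Qed.

Lemma funcalc_unique f Q1 Q2 : approx_funcalc f Q1 -> approx_funcalc f Q2 -> Q1 =1 Q2.
Proof.
move=> h1 h2 x; apply/eqP; rewrite -subr_eq0; apply/eqP.
apply: (@rnorm_small _ (2 * rnorm x)) => e e0 _.
have [p [pf pQ]] := h1 e e0.
have -> : Q1 x - Q2 x = (Q1 x - poly_op p P x) + (poly_op p P x - Q2 x).
  by rewrite addrA subrK.
apply: le_trans (ler_rnormD _ _) _; rewrite (rnormB (Q1 x)).
have := pQ x; have := funcalc_dist h2 pf x; lra.
Qed.

Lemma funcalc_ext f g Q : (forall u : R, 0 <= u <= opnorm P -> f u = g u) ->
  approx_funcalc f Q -> approx_funcalc g Q.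
Proof.
move=> fg h e e0; have [p [pf pQ]] := h e e0; exists p; split=> // u hu.
by rewrite -fg // pf.
Qed.

Lemma funcalc_poly p : approx_funcalc (fun u => p.[u]) (poly_op p P).
Proof.
move=> e e0; exists p; split=> [u _|x]; first by rewrite subrr normr0 ltW.
by rewrite subrr rnorm0 mulr_ge0 ?rnorm_ge0 // ltW.
Qed.

Lemma funcalc_sub f g Q1 Q2 : approx_funcalc f Q1 -> approx_funcalc g Q2 ->
  approx_funcalc (fun u => f u - g u) (fun x => Q1 x - Q2 x).
Proof.
move=> h1 h2 e e0; have e2 : 0 < e / 2 by lra.
have [p [pf pQ]] := h1 _ e2; have [q [qg qQ]] := h2 _ e2.
exists (p - q); split=> [u hu|x].
  rewrite hornerD hornerN (_ : _ - _ = (p.[u] - f u) - (q.[u] - g u)); last by ring.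
  by apply: le_trans (ler_normB _ _) _; have := pf u hu; have := qg u hu; lra.
rewrite poly_opB.
have -> : poly_op p P x - poly_op q P x - (Q1 x - Q2 x) =
  (poly_op p P x - Q1 x) - (poly_op q P x - Q2 x) by rewrite !opprD !opprK addrACA.
apply: le_trans (ler_rnormD _ _) _; rewrite rnormN.
have := pQ x; have := qQ x; lra.
Qed.

Lemma funcalc_mul f g Q1 Q2 : approx_funcalc f Q1 -> approx_funcalc g Q2 ->
  approx_funcalc (fun u => f u * g u) (fun x => Q1 (Q2 x)).
Proof.
move=> h1 h2 e e0.
have [F F0 fF] := funcalc_fun_bounded h1; have [G G0 gG] := funcalc_fun_bounded h2.
pose D := F + G + 1; have D0 : 0 < D by rewrite /D; lra.
pose a := Num.min 1 (e / D).
have a0 : 0 < a by rewrite lt_min ltr01 divr_gt0.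
have a1 : a <= 1 by rewrite ge_min lexx.
have aD : a * D <= e by rewrite -ler_pdivlMr // ge_min lexx orbT.
have [p [pf pQ]] := h1 _ a0; have [q [qg qQ]] := h2 _ a0.
have key : a * (G + a) + F * a <= e.
  apply: le_trans aD; rewrite /D; have : a * a <= a * 1 by rewrite ler_pM2l.
  lra.
have qB u : 0 <= u <= opnorm P -> `|q.[u]| <= G + a.
  move=> hu; have := ler_normD (g u) (q.[u] - g u); rewrite addrC subrK => h.
  by apply: le_trans h _; rewrite lerD ?gG ?qg.
exists (p * q); split=> [u hu|x].
  rewrite hornerM.
  rewrite (_ : _ - _ = (p.[u] - f u) * q.[u] + f u * (q.[u] - g u)); last by ring.
  apply: le_trans (ler_normD _ _) _; rewrite !normrM.
  apply: le_trans key; apply: lerD; first by rewrite ler_pM ?pf ?qB.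
  by rewrite ler_pM ?fF ?qg.
rewrite poly_opM //.
have -> : poly_op p P (poly_op q P x) - Q1 (Q2 x) =
   poly_op p P (poly_op q P x - Q2 x) + (poly_op p P (Q2 x) - Q1 (Q2 x)).
  by rewrite (linB (poly_op_linear PL p)) addrA subrK.
have pB u : 0 <= u <= opnorm P -> `|p.[u]| <= F + a.
  move=> hu; have := ler_normD (f u) (p.[u] - f u); rewrite addrC subrK => h.
  by apply: le_trans h _; rewrite lerD ?fF ?pf.
have i1 := poly_op_norm Hdot Ppos pB (poly_op q P x - Q2 x).
have i2 : (F + a) * rnorm (poly_op q P x - Q2 x) <= (F + a) * (a * rnorm x).
  by rewrite ler_wpM2l // addr_ge0 // ltW.
have i3 := pQ (Q2 x).
have i4 : a * rnorm (Q2 x) <= a * (G * rnorm x).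
  by rewrite ler_pM2l //; exact: funcalc_norm h2 gG x.
apply: le_trans (ler_rnormD _ _) _.
have i5 : (a * (G + a) + F * a) * rnorm x <= e * rnorm x by rewrite ler_wpM2r ?rnorm_ge0.
apply: le_trans i5; move: i1 i2 i3 i4; rewrite !mulrDl !mulrDr !mulrDl !mulrA; lra.
Qed.

Lemma funcalc_bounded f Q : approx_funcalc f Q -> bounded_operator Q.
Proof. by move=> h; have [C _ fC] := funcalc_fun_bounded h; exists C; exact: funcalc_norm h fC. Qed.

Lemma funcalc_linear f Q : approx_funcalc f Q -> linear Q.
Proof.
move=> h a x y; apply/eqP; rewrite -subr_eq0; apply/eqP.
pose B := rnorm (a *: x + y) + rnorm a * rnorm x + rnorm y.
apply: (@rnorm_small _ B) => e e0 _; have [p [_ pQ]] := h e e0.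
have -> : Q (a *: x + y) - (a *: Q x + Q y) =
   - (poly_op p P (a *: x + y) - Q (a *: x + y)) + a *: (poly_op p P x - Q x)
   + (poly_op p P y - Q y).
  rewrite (poly_op_linear PL) scalerBr; move: (poly_op p P x) (poly_op p P y) => b c.
  by rewrite opprB -[RHS]addrA [X in _ = _ + X]addrACA -opprD addrA subrK.
apply: le_trans (ler_rnormD _ _) _.
apply: le_trans (lerD (ler_rnormD _ _) (lexx _)) _; rewrite rnormN rnormZ /B.
have h1 := pQ (a *: x + y); have h3 := pQ y.
have h2 : rnorm a * rnorm (poly_op p P x - Q x) <= rnorm a * (e * rnorm x).
  by rewrite ler_wpM2l ?rnorm_ge0.
move: h1 h2 h3; rewrite !mulrDl; lra.
Qed.

Lemma funcalc_ge0 f Q : approx_funcalc f Q -> (forall u : R, 0 <= u <= opnorm P -> 0 <= f u) ->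
  forall x, 0 <= ip (Q x) x.
Proof.
move=> h f0 x; apply: (@le_epsP _ _ _ (2 * rnorm x ^+ 2)) => e e0 _.
have [p [pf pQ]] := h e e0.
have : 0 <= ip (poly_op (p + e%:P) P x) x.
  apply: (nonneg_poly Hdot Ppos) => u hu; rewrite hornerD hornerC.
  by have := pf u hu; have := f0 u hu; rewrite ler_norml => ? /andP[]; lra.
rewrite poly_opD poly_opC !ipE ipxx //.
have := ip_le Hdot (poly_op p P x - Q x) x; rewrite !ipE.
have := ler_wpM2r (rnorm_ge0 x) (pQ x); rewrite -[e * _ * _]mulrA -expr2; lra.
Qed.

Lemma funcalc_sym f Q : approx_funcalc f Q -> forall x y, dot (Q x) y = dot x (Q y).
Proof.
move=> h x y; apply/eqP; rewrite -subr_eq0; apply/eqP.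
apply: (@rnorm_eq0 R R[i]^o); apply/eqP; rewrite eq_le rnorm_ge0 andbT.
apply: (@le_epsP _ _ _ (2 * (rnorm x * rnorm y))) => e e0 _; rewrite add0r.
have [p [pf pQ]] := h e e0.
have -> : dot (Q x) y - dot x (Q y) =
    - dot (poly_op p P x - Q x) y + dot x (poly_op p P y - Q y).
  by rewrite dotBl dotBr (poly_op_sym Ppos); ring.
apply: le_trans (ler_rnormD _ _) _; rewrite rnormN.
have h1 := dot_le Hdot (poly_op p P x - Q x) y.
have h2 := dot_le Hdot x (poly_op p P y - Q y).
have h3 := ler_wpM2r (rnorm_ge0 y) (pQ x).
have h4 := ler_wpM2l (rnorm_ge0 x) (pQ y).
have -> : 2 * (rnorm x * rnorm y) * e = e * rnorm x * rnorm y + rnorm x * (e * rnorm y) by ring.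
by apply: lerD; [exact: le_trans h1 h3 | exact: le_trans h2 h4].
Qed.

Lemma funcalc_pos_op f Q : approx_funcalc f Q -> (forall u : R, 0 <= u <= opnorm P -> 0 <= f u) ->
  pos_op dot Q.
Proof.
move=> h f0; split; [exact: funcalc_linear h | exact: funcalc_bounded h | exact: funcalc_sym h |].
exact: funcalc_ge0 h f0.
Qed.

Lemma funcalc_le f g Q1 Q2 : approx_funcalc f Q1 -> approx_funcalc g Q2 ->
  (forall u : R, 0 <= u <= opnorm P -> f u <= g u) ->
  forall x, ip (Q1 x) x <= ip (Q2 x) x.
Proof.
move=> h1 h2 fg x; rewrite -subr_ge0 -ipNl -ipDl.
by apply: (funcalc_ge0 (funcalc_sub h2 h1)) => u hu; rewrite subr_ge0 fg.
Qed.

End FunCalc.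

Section FunCalcExists.
Context {R : realType} {H : completeNormedModType R[i]} (dot : {dot H for Num.conj}).
Hypothesis Hdot : hilbert_dot dot.
Variable P : H -> H.
Hypothesis Ppos : pos_op dot P.

(** The polynomials of [weierstrass], applied to P, are uniformly Cauchy by
    [poly_op_norm]. *)
Lemma funcalc_exists K f : 0 < K -> opnorm P <= K -> quad_cont K f ->
  exists Q, approx_funcalc P f Q.
Proof.
move=> K0 PK fK.
have ex (n : nat) : exists p : {poly R},
    forall u : R, 0 <= u <= opnorm P -> `|p.[u] - f u| <= n.+1%:R^-1.
  have n0 : 0 < (n.+1%:R^-1 : R) by rewrite invr_gt0.
  have [p _ hp] := weierstrass K0 fK n0; exists p => u /andP[u0 uP].
  by apply: hp; rewrite u0 (le_trans uP).
have [p hp] := choice ex.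
have pd n m e : n.+1%:R^-1 <= e -> m.+1%:R^-1 <= e ->
    forall x, rnorm (poly_op (p n) P x - poly_op (p m) P x) <= (2 * e) * rnorm x.
  move=> ne me x; rewrite -poly_opB; apply: (poly_op_norm Hdot Ppos) => u hu.
  rewrite hornerD hornerN (_ : _ - _ = ((p n).[u] - f u) - ((p m).[u] - f u)); last by ring.
  apply: le_trans (ler_normB _ _) _; have := le_trans (hp n u hu) ne.
  by have := le_trans (hp m u hu) me; lra.
have lim x : exists l : H, forall e : R, 0 < e -> exists N, forall n, (N <= n)%N ->
     rnorm (poly_op (p n) P x - l) <= e.
  apply: complete_rnorm => e e0.
  have x1 : 0 < 2 * rnorm x + 1 by have := rnorm_ge0 x; lra.
  have a0 : 0 < e / (2 * rnorm x + 1) by rewrite divr_gt0.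
  have [N hN] := invS_small a0; exists N => n m Nn Nm.
  apply: le_trans (pd n m _ (hN _ Nn) (hN _ Nm) x) _.
  set D := _ + 1 in x1 *; rewrite (_ : 2 * (e / D) * rnorm x = e * (2 * rnorm x) / D); last first.
    by move: (D^-1) (rnorm x) => b c; ring.
  by rewrite ler_pdivrMr // ler_pM2l // /D; lra.
have [Q hQ] := choice lim; exists Q => e e0.
have e4 : 0 < e / 4 by lra.
have [N hN] := invS_small e4; exists (p N); split=> [u hu|x].
  by apply: le_trans (hp N u hu) _; apply: le_trans (hN N (leqnn N)) _; lra.
apply: (@le_epsP _ _ _ 1) => a a0 _; have [N' hN'] := hQ x a a0.
set n := maxn N N'; have h1 := hN' n (leq_maxr _ _).
have h2 := pd N n _ (hN _ (leqnn N)) (hN n (leq_maxl _ _)) x.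
rewrite -(subrK (poly_op (p n) P x) (poly_op (p N) P x)) -addrA.
apply: le_trans (ler_rnormD _ _) _.
have : 2 * (e / 4) * rnorm x <= e * rnorm x by rewrite ler_wpM2r ?rnorm_ge0 //; lra.
lra.
Qed.

End FunCalcExists.

(** * The approximating polynomials *)

Section Cutoff.
Context {R : realType}.

Lemma min_lip (d u v : R) : 0 < d ->
  `|Num.min 1 (u / d) - Num.min 1 (v / d)| <= d^-1 * `|u - v|.
Proof.
move=> d0; wlog uv : u v / v <= u.
  move=> h; case/orP: (le_total u v) => uv; last exact: h.
  by rewrite distrC (distrC u); exact: h.
have i0 : 0 < d^-1 by rewrite invr_gt0.
have le : v / d <= u / d by rewrite ler_pM2r.
rewrite (ger0_norm (_ : 0 <= u - v)) ?subr_ge0 // [d^-1 * _]mulrC mulrBl.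
move: (u / d) (v / d) le => a b ba.
rewrite ger0_norm; by case: (leP 1 a) => h1; case: (leP 1 b) => h2; lra.
Qed.

(** X r approximates min(1, u / d) u^((1 - t) / 2). The first factor makes the
    function vanish at 0 even when t = 1, so that the approximant is divisible by X;
    it changes f(u)^2 u^t = u only for u < d. *)
Lemma cutoff_poly (K t e : R) : 0 < K -> 0 <= t <= 1 -> 0 < e ->
  exists r : {poly R}, forall u : R, 0 <= u <= K ->
    ('X * r).[u] ^+ 2 <= u `^ (1 - t) + e /\
    `|u - ('X * r).[u] ^+ 2 * u `^ t| <= e.
Proof.
move=> K0 /andP[t0 t1] e0; pose d := e / 2.
have d0 : 0 < d by rewrite /d; lra.
pose s := (1 - t) / 2.
have s01 : 0 <= s <= 1 by rewrite /s; apply/andP; split; lra.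
pose m u := Num.min 1 (u / d).
pose f u := m u * u `^ s.
have fc : quad_cont K f.
  apply: quad_contM; [exact: ltW | | by apply: quad_cont_powR => //; exact: ltW].
  by apply: (@quad_cont_lip _ _ d^-1) => [|u v _ _]; [rewrite invr_ge0 ltW | exact: min_lip].
have tc : quad_cont K (fun u => u `^ t).
  by apply: quad_cont_powR; [rewrite t0 | exact: ltW].
have [F F0 fF] := quad_cont_bounded (ltW K0) fc.
have [G G0 gG] := quad_cont_bounded (ltW K0) tc.
pose D := (1 + 2 * F) * (1 + G).
have D0 : 0 < D by rewrite /D mulr_gt0 //; lra.
pose a := Num.min 1 (e / 2 / D).
have a0 : 0 < a by rewrite lt_min ltr01 !divr_gt0.
have a1 : a <= 1 by rewrite ge_min lexx.
have aD : a * D <= e / 2 by rewrite -ler_pdivlMr // ge_min lexx orbT.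
have [p p0 pf] := weierstrass K0 fc a0.
have f0 : f 0 = 0 by rewrite /f /m mul0r /Num.min; case: ifP => //; rewrite ?mul0r // ltr10.
have /factor_theorem[r rE] : root p 0 by rewrite /root p0 f0.
exists r => u hu; have -> : 'X * r = p by rewrite rE subr0 mulrC.
have /andP[u0 uK] := hu.
have m0 : 0 <= m u by rewrite le_min ler01 divr_ge0 // ltW.
have m1 : m u <= 1 by rewrite ge_min lexx.
have mm : m u ^+ 2 <= 1 by rewrite expr_le1.
have sq : (u `^ s) ^+ 2 = u `^ (1 - t).
  by rewrite -powR_mulrn ?powR_ge0 // -powRrM /s divfK.
have ut : u `^ (1 - t) * u `^ t = u.
  by rewrite -powRD ?subrK ?powRr1 // oner_eq0.
have b0 := powR_ge0 u (1 - t).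
have diff : `|p.[u] ^+ 2 - f u ^+ 2| <= a * (1 + 2 * F).
  rewrite subr_sqr normrM ler_pM ?pf //.
  have := ler_normD (p.[u] - f u) (2 * f u).
  have -> : p.[u] - f u + 2 * f u = p.[u] + f u by ring.
  rewrite normrM (ger0_norm (_ : 0 <= 2)) //.
  have := pf u hu; have := fF u hu; lra.
have aFe : a * (1 + 2 * F) <= e.
  have : a * (1 + 2 * F) * (1 + G) <= e / 2 by rewrite -mulrA.
  have : 0 <= a * (1 + 2 * F) * G.
    by rewrite !mulr_ge0 // ?(ltW a0) ?(ltW G0) // addr_ge0 // mulr_ge0 // ltW.
  rewrite mulrDr mulr1; lra.
have f2 : f u ^+ 2 = m u ^+ 2 * u `^ (1 - t) by rewrite exprMn sq.
split.
  have : m u ^+ 2 * u `^ (1 - t) <= u `^ (1 - t) by rewrite ler_piMl.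
  move: diff; rewrite f2 ler_norml => /andP[_]; lra.
have -> : u - p.[u] ^+ 2 * u `^ t =
    (1 - m u ^+ 2) * u - (p.[u] ^+ 2 - f u ^+ 2) * u `^ t.
  have hut c : c * u `^ (1 - t) * u `^ t = c * u by rewrite -mulrA ut.
  rewrite f2 (mulrBl (u `^ t)) hut; ring.
apply: le_trans (ler_normB _ _) _; rewrite (normrM _ (u `^ t)).
have h1 : `|(1 - m u ^+ 2) * u| <= e / 2.
  rewrite ger0_norm ?mulr_ge0 ?subr_ge0 //.
  case: (leP 1 (u / d)) => ud.
    by rewrite /m (min_idPl ud) expr1n subrr mul0r; lra.
  have : u <= d by move: ud; rewrite ltr_pdivrMr // mul1r => /ltW.
  have : (1 - m u ^+ 2) * u <= u by rewrite ler_piMl // gerBl sqr_ge0.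
  rewrite /d; lra.
have h2 : `|p.[u] ^+ 2 - f u ^+ 2| * `|u `^ t| <= e / 2.
  apply: le_trans aD; rewrite /D mulrA ler_pM //.
  by apply: le_trans (gG u hu) _; lra.
by have := lerD h1 h2; lra.
Qed.

End Cutoff.

(** * Absolute values of operators *)

Section AbsoluteValue.
Context {R : realType} {H : completeNormedModType R[i]} (dot : {dot H for Num.conj}).
Hypothesis Hdot : hilbert_dot dot.
Notation ip := (ip dot).

Lemma op_powP P s : pos_op dot P -> 0 <= s <= 1 ->
  approx_funcalc P (fun u => u `^ s) (op_pow P s).
Proof.
move=> PP s01; rewrite /op_pow; case: xgetP => [Q _ hQ|no].
  exact: approx_of_is_funcalc.
have K0 : 0 < opnorm P + 1 by have := opnormP0 PP; lra.
have [|Q hQ] := funcalc_exists Hdot PP K0 _ (quad_cont_powR s01 (ltW K0)); first by lra.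
by have := no Q (is_funcalc_of_approx hQ).
Qed.

Lemma bounded_comp (S T : H -> H) : linear S ->
  bounded_operator S -> bounded_operator T -> bounded_operator (S \o T).
Proof.
move=> SL SB [M TM]; exists (opnorm S * M) => x /=.
apply: le_trans (opnorm_ub _ SL SB) _.
by rewrite -mulrA ler_wpM2l // opnorm_ge0.
Qed.

Lemma gram_pos (A B : H -> H) : linear A -> linear B -> bounded_operator A ->
  bounded_operator B -> (forall x y, dot (A x) y = dot x (B y)) ->
  pos_op dot (B \o A).
Proof.
move=> AL BL AB BB AdjB; split => /=.
- by move=> a x y /=; rewrite AL BL.
- exact: bounded_comp.
- by move=> x y; rewrite (adjoint_sym AdjB) AdjB.
- by move=> x; rewrite /ip (adjoint_sym AdjB) -/(ip _ _) ipxx // sqr_ge0.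
Qed.

Lemma sqrt_pos P : pos_op dot P -> pos_op dot (op_pow P 2^-1).
Proof.
move=> PP; have s01 : 0 <= (2^-1 : R) <= 1 by apply/andP; split; lra.
by apply: (funcalc_pos_op Hdot PP (op_powP PP s01)) => u _; exact: powR_ge0.
Qed.

Lemma sqrt_sq P x : pos_op dot P -> op_pow P 2^-1 (op_pow P 2^-1 x) = P x.
Proof.
move=> PP; have s01 : 0 <= (2^-1 : R) <= 1 by apply/andP; split; lra.
have h := op_powP PP s01.
have h2 := funcalc_mul Hdot PP h h.
rewrite -[RHS](poly_opX (pos_lin PP)); apply: (funcalc_unique Hdot PP h2).
apply: (funcalc_ext _ (funcalc_poly _ 'X)) => u /andP[u0 _].
by rewrite hornerX powR12_sqrt // -expr2 sqr_sqrtr.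
Qed.

Section Pair.
Variables A B : H -> H.
Hypotheses (AL : linear A) (BL : linear B)
  (Abnd : bounded_operator A) (Bbnd : bounded_operator B).
Hypothesis AdjB : forall x y, dot (A x) y = dot x (B y).
Let BA := gram_pos AL BL Abnd Bbnd AdjB.
Let AB := gram_pos BL AL Bbnd Abnd (adjoint_sym AdjB).
Let P := op_pow (B \o A) 2^-1.
Let N := op_pow (A \o B) 2^-1.
Let PP : pos_op dot P := sqrt_pos BA.
Let NP : pos_op dot N := sqrt_pos AB.

Lemma abs_norm x : rnorm (P x) = rnorm (A x).
Proof.
apply/eqP; rewrite -(@eqrXn2 _ 2) ?rnorm_ge0 //; apply/eqP.
rewrite -!(ipxx Hdot) /ip (pos_sym PP) AdjB.
by have -> : P (P x) = B (A x) := sqrt_sq x BA.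
Qed.

(** A p(B A) = p(A B) A for every polynomial p; take p close to the square root on an
    interval containing [0, ||B A||] and [0, ||A B||]. *)
Lemma abs_intertwine x : A (P x) = N (A x).
Proof.
apply/eqP; rewrite -subr_eq0; apply/eqP.
pose K := opnorm (B \o A) + opnorm (A \o B) + 1.
have o1 := opnormP0 BA; have o2 := opnormP0 AB.
have K0 : 0 < K by rewrite /K; lra.
have s01 : 0 <= (2^-1 : R) <= 1 by apply/andP; split; lra.
have h1 := op_powP BA s01; have h2 := op_powP AB s01.
apply: (@rnorm_small _ _ _ (opnorm A * rnorm x + rnorm (A x))) => e e0 _.
have [q _ hq] := weierstrass K0 (quad_cont_powR s01 (ltW K0)) e0.
have d1 : rnorm (poly_op q (B \o A) x - P x) <= e * rnorm x.
  apply: (funcalc_dist Hdot BA h1) => u /andP[u0 u1].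
  by apply: hq; rewrite u0 (le_trans u1) // /K; lra.
have d2 : rnorm (poly_op q (A \o B) (A x) - N (A x)) <= e * rnorm (A x).
  apply: (funcalc_dist Hdot AB h2) => u /andP[u0 u1].
  by apply: hq; rewrite u0 (le_trans u1) // /K; lra.
have -> : A (P x) - N (A x) = - A (poly_op q (B \o A) x - P x) +
    (poly_op q (A \o B) (A x) - N (A x)).
  rewrite (linB AL) (@poly_op_intertwine _ _ A (B \o A) (A \o B)) //;
    [|exact: pos_lin BA|exact: pos_lin AB].
  by rewrite opprB addrA subrK.
apply: le_trans (ler_rnormD _ _) _; rewrite rnormN mulrDl; apply: lerD; last by rewrite mulrC.
apply: le_trans (opnorm_ub _ AL Abnd) _.
by rewrite -mulrA (mulrC _ e) ler_wpM2l // opnorm_ge0.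
Qed.

(** The weight s = wF + e in [pos_amgm] is chosen so that s^-1 (qy + py) <= Y: after
    the two inequalities are added, this term is absorbed by half of the left-hand
    side 2 Y. The summand e keeps s positive. *)
Lemma weighted_bound (wF wG e Y qx qy wx py i1 i2 : R) :
  0 <= wF -> 0 <= wG -> 0 < e -> e <= 1 ->
  2 * i1 <= (wF + e) * qx + (wF + e)^-1 * qy ->
  2 * i2 <= (wF + e) * wx + (wF + e)^-1 * py ->
  qx + wx <= wG + e -> qy + py <= (wF + e) * Y -> Y = i1 + i2 ->
  Y <= wF * wG + (wF + wG + 1) * e.
Proof.
move=> wF0 wG0 e0 e1; set s := wF + e.
have s0 : 0 < s by rewrite /s; lra.
have si : 0 < s^-1 by rewrite invr_gt0.
move=> h1 h2 hx hy hY.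
have j1 : s * (qx + wx) <= s * (wG + e) by rewrite ler_pM2l.
have j2 : s^-1 * (qy + py) <= Y.
  have : s^-1 * (qy + py) <= s^-1 * (s * Y) by rewrite ler_pM2l.
  by rewrite mulKf // gt_eqF.
have j3 : Y <= s * (wG + e) by move: h1 h2 j1 j2; rewrite !mulrDr; lra.
have ee : e * e <= e * 1 by rewrite ler_pM2l.
by apply: le_trans j3 _; rewrite /s !mulrDl !mulrDr; lra.
Qed.

(** Cauchy-Schwarz for the form <Q x, y>, with a free weight s in place of square
    roots. *)
Lemma pos_amgm Q (s : R) x y : pos_op dot Q -> 0 < s ->
  2 * ip (Q x) y <= s * ip (Q x) x + s^-1 * ip (Q y) y.
Proof.
move=> QQ s0; have := pos_ge0 QQ (s%:C *: x - y).
rewrite (linB (pos_lin QQ)) (linZ (pos_lin QQ)) !ipE.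
have -> : ip (Q y) x = ip (Q x) y by rewrite ipC [in RHS]/ip (pos_sym QQ).
move: (ip (Q x) x) (ip (Q x) y) (ip (Q y) y) => a b c h.
have {}h : 0 <= s^-1 * (s * (s * a) - s * b - (s * b - c)).
  by rewrite mulr_ge0 // ?invr_ge0 ?(ltW s0).
rewrite -subr_ge0; apply: le_trans h _; rewrite le_eqVlt; apply/orP; left; apply/eqP.
by field; rewrite gt_eqF.
Qed.

(** The bound for one operator. Here z stands for W' x: <a, z> is <A x, x> up to e,
    and <z, y> = <w, p(P) y>, where |p(P) y|^2 and |w|^2 are at most
    <P^(1-t) y, y> and <N^(1-t) x, x> up to e. *)
Lemma numerical_bound (t wF wG : R) : 0 <= t <= 1 -> 0 <= wF -> 0 <= wG ->
  (forall y, ip (op_pow P (1 - t) y) y + ip (op_pow P t y) y <= wF * rnorm y ^+ 2) ->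
  (forall y, ip (op_pow P t y) y + ip (op_pow N (1 - t) y) y <= wG * rnorm y ^+ 2) ->
  forall x, rnorm x = 1 -> rnorm (dot (A x) x) <= 4^-1 * (wF * wG).
Proof.
move=> t01 wF0 wG0 hF hG x x1.
have t01' : 0 <= 1 - t <= 1 by case/andP: t01 => t0 t1; apply/andP; split; lra.
have fP := op_powP PP t01; have fP' := op_powP PP t01'; have fN' := op_powP NP t01'.
have PL := pos_lin PP; have NL := pos_lin NP.
set Qt := op_pow P t in fP hF hG; set Q1 := op_pow P (1 - t) in fP' hF.
set N1 := op_pow N (1 - t) in fN' hG.
have QtP : pos_op dot Qt by apply: (funcalc_pos_op Hdot PP fP) => u _; exact: powR_ge0.
apply: (@le_epsP _ _ _ (1 + (wF + wG + 1))) => e e0 e1.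
pose K := opnorm P + opnorm N + 1.
have o1 := opnormP0 PP; have o2 := opnormP0 NP.
have K0 : 0 < K by rewrite /K; lra.
have [r hr] := cutoff_poly K0 t01 e0; set p := 'X * r in hr.
have inP (u : R) : 0 <= u <= opnorm P -> 0 <= u <= K.
  by move=> /andP[u0 u1]; rewrite u0 (le_trans u1) // /K; lra.
have inN (u : R) : 0 <= u <= opnorm N -> 0 <= u <= K.
  by move=> /andP[u0 u1]; rewrite u0 (le_trans u1) // /K; lra.
pose a := Qt x.
pose w := poly_op r P (B x).
pose z := poly_op p P w.
have pE q y : poly_op ('X * q) P y = P (poly_op q P y) by exact: poly_opXM.
have Adot : dot a z = dot (A (poly_op r P (poly_op p P a))) x.
  by rewrite /z /w AdjB -!(poly_op_sym PP).
have approx : rnorm (A x - A (poly_op r P (poly_op p P a))) <= e.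
  rewrite -(linB AL) -abs_norm (linB PL) -pE -/p.
  have h := funcalc_sub (funcalc_poly P 'X) (funcalc_mul Hdot PP (funcalc_poly P (p * p)) fP).
  rewrite -[P x](poly_opX PL) -(poly_opM PL).
  rewrite -[leRHS]mulr1 -x1; apply: (funcalc_norm Hdot PP h) => u hu /=.
  by rewrite hornerX hornerM -expr2; exact: (hr u (inP u hu)).2.
have Adist : rnorm (dot (A x) x) <= e + rnorm (dot a z).
  rewrite -[dot (A x) x](subrK (dot a z)); apply: le_trans (ler_rnormD _ _) _.
  rewrite lerD2r Adot -dotBl; apply: le_trans (dot_le Hdot _ _) _.
  by rewrite x1 mulr1.
have [c c1 hc] := dot_polar Hdot a z.
set y := a + c *: z in hc; have yE : y = a + c *: z by [].
clearbody y.
have pyB : rnorm (poly_op p P y) ^+ 2 <= ip (Q1 y) y + e * rnorm y ^+ 2.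
  have h : ip (poly_op (p * p - e%:P) P y) y <= ip (Q1 y) y.
    apply: (funcalc_le Hdot PP (funcalc_poly P _) fP') => u hu /=.
    by rewrite hornerD hornerN hornerC hornerM -expr2 lerBlDr; exact: (hr u (inP u hu)).1.
  move: h; rewrite poly_opB poly_opC !ipE ipxx // (poly_opM PL) /ip.
  by rewrite (poly_op_sym PP) -!/(ip _ _) ipxx //; lra.
have wB : rnorm w ^+ 2 <= ip (N1 x) x + e.
  have h : ip (poly_op (p * p - e%:P) N x) x <= ip (N1 x) x.
    apply: (funcalc_le Hdot NP (funcalc_poly N _) fN') => u hu /=.
    by rewrite hornerD hornerN hornerC hornerM -expr2 lerBlDr; exact: (hr u (inN u hu)).1.
  move: h; rewrite poly_opB poly_opC !ipE ipxx // x1 expr1n mulr1 => h.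
  have -> : rnorm w ^+ 2 = ip (poly_op (p * p) N x) x; last by lra.
  (* |r(P) B x|^2 = <A r(P)^2 B x, x> = <r(N)^2 A B x, x> and A B = N^2. *)
  have -> : p * p = (r * r) * ('X * 'X) by rewrite /p; ring.
  have NN v : poly_op ('X * 'X) N v = A (B v).
    by rewrite (poly_opM NL) !(poly_opX NL); exact: sqrt_sq v AB.
  rewrite (poly_opM NL) NN -(poly_op_intertwine _ _ AL PL NL abs_intertwine).
  by rewrite -(ipxx Hdot) /ip AdjB (poly_opM PL) [in RHS](poly_op_sym PP).
pose s := wF + e.
have s0 : 0 < s by rewrite /s; lra.
have cz : ip (c *: z) y = ip (c *: w) (poly_op p P y).
  by rewrite /ip !dotZl /z (poly_op_sym PP).
have i1 := pos_amgm x y QtP s0.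
have i2 : 2 * ip (c *: z) y <= s * rnorm w ^+ 2 + s^-1 * rnorm (poly_op p P y) ^+ 2.
  have idP : pos_op dot (@id H).
    by split => // [|v]; [exists 1 => v; rewrite mul1r | rewrite ipxx // sqr_ge0].
  have := pos_amgm (c *: w) (poly_op p P y) idP s0.
  by rewrite cz !ipxx // rnormZ c1 mul1r.
have yy : rnorm y ^+ 2 = ip a y + ip (c *: z) y by rewrite -(ipxx Hdot) {1}yE ipDl.
have hGx := hG x; have hFy := hF y; rewrite x1 expr1n mulr1 in hGx.
have hx : ip a x + rnorm w ^+ 2 <= wG + e.
  by apply: le_trans (lerD (lexx _) wB) _; rewrite addrA lerD2r.
have hy : ip (Qt y) y + rnorm (poly_op p P y) ^+ 2 <= s * rnorm y ^+ 2.
  apply: le_trans (lerD (lexx _) pyB) _.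
  by rewrite addrA (addrC (ip _ _)) /s mulrDl lerD2r.
have yb := weighted_bound wF0 wG0 e0 e1 i1 i2 hx hy yy.
apply: le_trans Adist _; rewrite mulrDl mul1r addrCA lerD2l.
apply: le_trans hc _; apply: le_trans (ler_wpM2l _ yb) _; first by rewrite invr_ge0.
rewrite mulrDr lerD2l ler_piMl // ?mulr_ge0 ?(ltW e0) //; first by rewrite !addr_ge0.
by rewrite invf_le1 // ler1n.
Qed.

End Pair.
End AbsoluteValue.

(** * Euclidean operator radius *)

Section EuclideanRadius.
Context {R : realType} {H : normedModType R[i]} (dot : {dot H for Num.conj}).
Hypothesis Hdot : hilbert_dot dot.
Variables (d : nat) (T : 'I_d -> H -> H).

Lemma euclidean_radius_ub x k : (forall k, bounded_operator (T k)) -> rnorm x = 1 ->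
  rnorm (dot (T k x) x) <= euclidean_radius dot T.
Proof.
move=> TB x1; have [M TM] := choice TB.
apply: (@le_trans _ _ (Num.sqrt (\sum_(k < d) rnorm (dot (T k x) x) ^+ 2))).
  rewrite -[leLHS]ger0_norm ?rnorm_ge0 // -sqrtr_sqr ler_wsqrtr //.
  by rewrite (bigD1 k) //= lerDl sumr_ge0 // => i _; rewrite sqr_ge0.
apply: ub_le_sup; last by exists x.
exists (Num.sqrt (\sum_(k < d) M k ^+ 2)) => _ [y /= y1 <-].
apply: ler_wsqrtr; apply: ler_sum => i _.
have h : rnorm (dot (T i y) y) <= M i.
  apply: le_trans (dot_le Hdot _ _) _; rewrite y1 mulr1.
  by have := TM i y; rewrite y1 mulr1.
by rewrite lerXn2r ?nnegrE ?rnorm_ge0 // (le_trans (rnorm_ge0 _) h).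
Qed.

Lemma euclidean_radius_quad k y : (forall k, linear (T k)) ->
  (forall k, bounded_operator (T k)) ->
  ip dot (T k y) y <= euclidean_radius dot T * rnorm y ^+ 2.
Proof.
move=> TL TB; have [y0|yN0] := eqVneq (rnorm y) 0.
  by rewrite (rnorm_eq0 y0) ipC ip0l rnorm0 expr0n mulr0.
have yp : 0 < rnorm y by rewrite lt_def yN0 rnorm_ge0.
pose x := ((rnorm y)^-1)%:C *: y.
have x1 : rnorm x = 1.
  by rewrite rnormZ rnorm_real ger0_norm ?invr_ge0 ?rnorm_ge0 // mulVf.
have yE : y = (rnorm y)%:C *: x by rewrite scalerA -rmorphM /= divff // scale1r.
have -> : ip dot (T k y) y = rnorm y ^+ 2 * ip dot (T k x) x.
  by rewrite {1 2}yE (linZ (TL k)) !ipE mulrA -expr2.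
rewrite mulrC ler_pM2r ?exprn_gt0 //; apply: le_trans (euclidean_radius_ub k TB x1).
by apply: le_trans (rnorm_Re _); exact: ler_norm.
Qed.

End EuclideanRadius.

Theorem corollary3p10 (R : realType) (H : completeNormedModType R[i])
    (dot : {dot H for Num.conj}) (Hdot : hilbert_dot dot)
    (d : nat) (d_ge1 : (1 <= d)%N)
    (A : 'I_d -> {linear H -> H})
    (A_bounded : forall k : 'I_d, bounded_operator (A k))
    (t : R) (t01 : 0 <= t <= 1) :
  euclidean_radius dot A <=
    Num.sqrt d%:R / 4
    * euclidean_radius dot
        (tuple_add (tuple_abs_pow dot A (1 - t)) (tuple_abs_pow dot A t))
    * euclidean_radius dot
        (tuple_add (tuple_abs_pow dot A t)
                   (tuple_abs_pow dot (tuple_adjoint dot A) (1 - t))).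
Proof.
have t01' : 0 <= 1 - t <= 1 by case/andP: t01 => t0 t1; apply/andP; split; lra.
set F := tuple_add _ (tuple_abs_pow dot A t).
set G := tuple_add (tuple_abs_pow dot A t) _.
have AL k : linear (A k) := linearP (A k).
have AdjA k := adjointP Hdot (AL k) (A_bounded k).
have SL k := adjoint_linear Hdot (AdjA k).
have SB k := adjoint_bounded Hdot (AdjA k) (A_bounded k).
have AA k : adjoint dot (adjoint dot (A k)) = A k.
  exact: (adjoint_unique Hdot (adjoint_sym (AdjA k)) (SB k) (SL k)).
have PP k := sqrt_pos Hdot (gram_pos Hdot (AL k) (SL k) (A_bounded k) (SB k) (AdjA k)).
have NP k := sqrt_pos Hdot
  (gram_pos Hdot (SL k) (AL k) (SB k) (A_bounded k) (adjoint_sym (AdjA k))).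
have pow_pos P s : pos_op dot P -> 0 <= s <= 1 -> pos_op dot (op_pow P s).
  move=> Pp s01; apply: (funcalc_pos_op Hdot Pp (op_powP Hdot Pp s01)) => u _.
  exact: powR_ge0.
have addL (S T : H -> H) : pos_op dot S -> pos_op dot T -> linear (S \+ T).
  by move=> [SL' _ _ _] [TL' _ _ _] a x y /=; rewrite SL' TL' scalerDr addrACA.
have addB (S T : H -> H) : pos_op dot S -> pos_op dot T -> bounded_operator (S \+ T).
  move=> [_ [M SM] _ _] [_ [M' TM] _ _]; exists (M + M') => x /=.
  by apply: le_trans (ler_rnormD _ _) _; rewrite mulrDl lerD.
have NE k : op_abs dot (tuple_adjoint dot A k) = op_pow (A k \o adjoint dot (A k)) 2^-1.
  by rewrite /op_abs /tuple_adjoint AA.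
have NP' k : pos_op dot (op_abs dot (tuple_adjoint dot A k)) by rewrite NE; exact: NP.
have FL k : linear (F k) by apply: addL; apply: pow_pos => //; exact: PP.
have FB k : bounded_operator (F k) by apply: addB; apply: pow_pos => //; exact: PP.
have GL k : linear (G k) by apply: addL; apply: pow_pos => //; exact: PP.
have GB k : bounded_operator (G k) by apply: addB; apply: pow_pos => //; exact: PP.
(* Without unit vectors all three radii are suprema of the empty set. *)
have [[x0 x01]|no1] := pselect (exists x : H, rnorm x = 1); last first.
  have er0 (T : 'I_d -> H -> H) : euclidean_radius dot T = 0.
    rewrite /euclidean_radius (_ : [set x : H | rnorm x = 1] = set0).
      by rewrite image_set0 sup0.
    by apply/seteqP; split => // x xs; case: no1; exists x.
  by clear -er0; clearbody F G; rewrite !er0 mulr0.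
pose k0 : 'I_d := Ordinal d_ge1.
have F0 : 0 <= euclidean_radius dot F.
  by apply: le_trans (rnorm_ge0 _) (euclidean_radius_ub Hdot k0 FB x01).
have G0 : 0 <= euclidean_radius dot G.
  by apply: le_trans (rnorm_ge0 _) (euclidean_radius_ub Hdot k0 GB x01).
apply: ge_sup; first by exists (Num.sqrt (\sum_(k < d) rnorm (dot (A k x0) x0) ^+ 2)), x0.
move=> _ [x /= x1 <-].
set w := 4^-1 * (euclidean_radius dot F * euclidean_radius dot G).
have w0 : 0 <= w by apply: mulr_ge0; [rewrite invr_ge0 | exact: mulr_ge0 F0 G0].
have wA k : rnorm (dot (A k x) x) <= w.
  apply: (numerical_bound Hdot (AL k) (SL k) (A_bounded k) (SB k) (AdjA k) t01) => // y.
    by rewrite -ipDl; exact: (euclidean_radius_quad Hdot k y FL FB).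
  have := euclidean_radius_quad Hdot k y GL GB; rewrite ipDl /tuple_abs_pow NE.
  by [].
apply: (@le_trans _ _ (Num.sqrt (\sum_(k < d) w ^+ 2))).
  by apply/ler_wsqrtr/ler_sum => k _; rewrite lerXn2r ?nnegrE ?rnorm_ge0.
rewrite sumr_const card_ord -[w ^+ 2 *+ _]mulr_natl sqrtrM // sqrtr_sqr ger0_norm //.
by rewrite /w !mulrA.
Qed.
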